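(* For every space bound $\mathcal{S}\le\mathcal{O}^{*}(3^{n/4})$, \textsc{Equal-Subset-Sum} on $n$ integers can be solved in space $\mathcal{S}$ and time $\mathcal{T}\le\mathcal{O}^{*}\left(\frac{3^n}{\mathcal{S}^2}\right)$.
   Context: \textsc{Equal-Subset-Sum}: given a set $S$ of $n$ integers, decide whether there exist two disjoint nonempty subsets $A,B\subseteq S$ with $\sum_{x\in A}x=\sum_{x\in B}x$. The notation $\mathcal{O}^{*}(\cdot)$ hides factors polynomial in the input size. *)

(* Defs.v *)
From Stdlib Require Import Reals ZArith List.
Import ListNotations.

(** ** The problem *)

Definition Zsum (l : list Z) : Z := fold_right Z.add 0%Z l.

(** A set of [n] integers is a duplicate-free list of length [n]. *)
Definition equal_subset_sum (X : list Z) : Prop :=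
  exists A B : list Z,
    NoDup A /\ NoDup B /\ incl A X /\ incl B X /\
    A <> [] /\ B <> [] /\ (forall x, In x A -> ~ In x B) /\
    Zsum A = Zsum B.

(** ** Random-access machine with logarithmic cost

    Programs are structured RAM programs.  A state consists of two dense arrays
    of integers: the registers, which a program addresses by constants only (so
    it uses a bounded number of them), and the memory, addressed by computed
    values.  All cells are initially zero except for the input.  Time and space
    are both counted in bits. *)

(** Binary length of [Z.abs z] (at least one digit), plus a sign bit. *)
Definition bits (z : Z) : nat := (Z.to_nat (Z.log2 (Z.abs z)) + 2)%nat.

Inductive binop : Type := Add | Sub | Mul | Div | Mod | Lt | Eq.

Definition eval_op (o : binop) (a b : Z) : Z :=
  match o with
  | Add => a + b
  | Sub => a - b
  | Mul => a * b
  | Div => a / b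
  | Mod => a mod b
  | Lt => Z.b2z (a <? b)
  | Eq => Z.b2z (a =? b)
  end%Z.

Inductive expr : Type :=
| Lit (z : Z)
| Reg (i : nat)
| Bin (o : binop) (e1 e2 : expr).

Inductive cmd : Type :=
| Skip
| Assign (i : nat) (e : expr)       (* reg[i] := e *)
| Fetch (i : nat) (e : expr)        (* reg[i] := mem[e] *)
| Store (e1 e2 : expr)              (* mem[e1] := e2 *)
| Seq (c1 c2 : cmd)
| If (e : expr) (c1 c2 : cmd)       (* any nonzero value is true *)
| While (e : expr) (c : cmd).

Record state : Type := State { regs : list Z; mem : list Z }.

(** Cells past the end of a list hold [0]; writing there extends the list with
    zeros, so that the space below counts every cell up to the highest one ever
    written.  Negative addresses are read as [0] through [Z.to_nat]. *)
Definition get (l : list Z) (i : nat) : Z := nth i l 0%Z.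

Fixpoint put (l : list Z) (i : nat) (v : Z) {struct i} : list Z :=
  match i, l with
  | O, [] => [v]
  | O, _ :: t => v :: t
  | S j, [] => 0%Z :: put [] j v
  | S j, h :: t => h :: put t j v
  end.

Definition set_reg (s : state) (i : nat) (v : Z) : state :=
  State (put (regs s) i v) (mem s).

Definition set_mem (s : state) (a v : Z) : state :=
  State (regs s) (put (mem s) (Z.to_nat a) v).

Definition list_bits (l : list Z) : nat := list_sum (map bits l).

(** The temporaries of an expression are not counted: a program contains
    finitely many expressions, and the length of a temporary is at most linear
    in that of the registers and literals it is computed from. *)
Definition space (s : state) : nat := (list_bits (regs s) + list_bits (mem s))%nat.

Fixpoint eval (s : state) (e : expr) : Z :=
  match e with
  | Lit z => z
  | Reg i => get (regs s) i
  | Bin o e1 e2 => eval_op o (eval s e1) (eval s e2)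
  end.

(** Every operation is charged the lengths of its operands and of its result. *)
Fixpoint cost (s : state) (e : expr) : nat :=
  match e with
  | Lit _ | Reg _ => bits (eval s e)
  | Bin _ e1 e2 => cost s e1 + cost s e2 + bits (eval s e)
  end%nat.

(** [exec c s s' t m]: started in [s], the command [c] halts in [s'] after time
    [t], and [m] is the maximum of [space] over all states visited. *)
Inductive exec : cmd -> state -> state -> nat -> nat -> Prop :=
| exec_skip s :
    exec Skip s s 1 (space s)
| exec_assign s i e :
    let s' := set_reg s i (eval s e) in
    exec (Assign i e) s s' (cost s e) (Nat.max (space s) (space s'))
| exec_fetch s i e :
    let v := get (mem s) (Z.to_nat (eval s e)) in
    let s' := set_reg s i v in
    exec (Fetch i e) s s' (cost s e + bits v) (Nat.max (space s) (space s'))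
| exec_store s e1 e2 :
    let s' := set_mem s (eval s e1) (eval s e2) in
    exec (Store e1 e2) s s' (cost s e1 + cost s e2) (Nat.max (space s) (space s'))
| exec_seq c1 c2 s s1 s2 t1 t2 m1 m2 :
    exec c1 s s1 t1 m1 -> exec c2 s1 s2 t2 m2 ->
    exec (Seq c1 c2) s s2 (t1 + t2) (Nat.max m1 m2)
| exec_if_true e c1 c2 s s' t m :
    eval s e <> 0%Z -> exec c1 s s' t m ->
    exec (If e c1 c2) s s' (cost s e + t) m
| exec_if_false e c1 c2 s s' t m :
    eval s e = 0%Z -> exec c2 s s' t m ->
    exec (If e c1 c2) s s' (cost s e + t) m
| exec_while_true e c s s1 s2 t1 t2 m1 m2 :
    eval s e <> 0%Z -> exec c s s1 t1 m1 -> exec (While e c) s1 s2 t2 m2 ->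
    exec (While e c) s s2 (cost s e + t1 + t2) (Nat.max m1 m2)
| exec_while_false e c s :
    eval s e = 0%Z ->
    exec (While e c) s s (cost s e) (space s).

(** ** Solving the problem within a space budget *)

(** Number of bits of the instance; it is at least [length X]. *)
Definition input_size (X : list Z) : nat := list_bits X.

(** The set of integers is in memory, its cardinality in register 0, and the
    space budget that the algorithm is allowed in register 1. *)
Definition init (budget : nat) (X : list Z) : state :=
  State [Z.of_nat (length X); Z.of_nat budget] X.

(** A space bound is a function of the number of integers and of the input size. *)
Definition budget (Sp : nat -> nat -> nat) (X : list Z) : nat :=
  Sp (length X) (input_size X).

(** [P] decides the problem on every instance [X], in time exactly [T X] and
    space exactly [M X]; the answer is "yes" iff register 0 finally holds 1. *)
Definition solves_equal_subset_sum
    (P : cmd) (Sp : nat -> nat -> nat) (T M : list Z -> nat) : Prop :=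
  forall X : list Z, NoDup X ->
    exists s : state,
      exec P (init (budget Sp X) X) s (T X) (M X) /\
      (get (regs s) 0 = 1%Z <-> equal_subset_sum X).

(** [f <= O*(g)] for functions of the instance: [f <= poly(input size) * g]. *)
Definition Ostar_le (f g : list Z -> R) : Prop :=
  exists c k : nat, forall X : list Z, NoDup X ->
    (f X <= INR c * (INR (input_size X) + 1) ^ k * g X)%R.

(* Main.v *)
Require Import Defs.
From Stdlib Require Import Reals ZArith List Lia Lra Permutation ClassicalEpsilon.
Import ListNotations.

(** Two disjoint nonempty sets with equal sums are a vector [eps] in
    [{-1, 0, 1}^n] that takes both values [1] and [-1] and satisfies
    [sum eps_p * x_p = 0].  Let [q] be maximal with [3 ^ q <= S] and [4 * q <= n],
    and [N = 3 ^ q].  Choose in all possible ways a position where [eps] is [1], one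
    where it is [-1], and the [n - 4 * q] last entries of [eps]; what remains is to
    find [a + b = c + d] with one summand from each of four lists of [N] signed sums,
    the lists of the four blocks of [q] positions.  As in the algorithm of Schroeppel
    and Shamir, the sums [a + b] and [c + d] are enumerated in increasing order and
    merged: with the values [b] sorted, each [a] needs only a pointer to its next [b],
    and a tournament tree over the [N] lists [a + b] yields the least next sum.  The
    merge takes [N ^ 2] tree updates and [O(N)] cells, so the total time is
    [3 ^ (n - 4 * q) * N ^ 2 = 3 ^ n / N ^ 2] up to polynomial factors, and [N] is at
    least [S] up to a polynomial factor: either [3 * N > S], or [4 * q + 4 > n] and
    the hypothesis bounds [S] by [3 ^ (n / 4)].

    All polynomial factors come from one uniform bound: if no cell ever exceeds
    [2 ^ lb] in absolute value, an elementary command costs [O(lb)], so it suffices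
    to count commands. *)

Local Open Scope Z_scope.

(** * Machine states as functions *)

(** The zero vector also satisfies [sum eps_p * x_p = 0]; forcing one entry to [1] and one to [-1]
    excludes it and makes both sets nonempty, at the price of a factor [n ^ 2]. The sorted values
    [b] come from repeated search for the next larger value, [N + 1] passes over [N] codes: this
    needs no space beside the table and stays within the [N ^ 2] that the merge spends anyway. The
    values [a] are not stored at all: a leaf holds its current sum together with the indices, and
    the next sum of the same list differs from it by a difference of two values [b]. The merge may
    drop the smaller of two unequal least sums because that sum can match nothing any more; the
    proof states this as a property of all sums dropped so far. The length bound [lb] must cover the
    budget too, which sits in a register, so it depends on the constants hidden in the hypothesis on
    [S]. Registers and memory are brought to their final length by one write each before the search,
    so that every other command acts on states of constant shape. *)

Definition updr (f : nat -> Z) (i : nat) (v : Z) (j : nat) : Z :=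
  if Nat.eqb i j then v else f j.

Definition updm (m : Z -> Z) (a v b : Z) : Z := if a =? b then v else m b.

(** The program first writes register 30, which gives the register list this length; from then on
    [put] acts as a function update. *)
Definition nregs : nat := 31.

Definition cells (L : nat) (m : Z -> Z) : list Z :=
  map (fun a => m (Z.of_nat a)) (seq 0 L).

Definition st (L : nat) (f : nat -> Z) (m : Z -> Z) : state :=
  State (map f (seq 0 nregs)) (cells L m).

Fixpoint evalf (f : nat -> Z) (e : expr) : Z :=
  match e with
  | Lit z => z
  | Reg i => f i
  | Bin o e1 e2 => eval_op o (evalf f e1) (evalf f e2)
  end.

Fixpoint esize (e : expr) : nat :=
  match e with
  | Lit _ | Reg _ => 1
  | Bin _ e1 e2 => esize e1 + esize e2 + 1
  end%nat.

Fixpoint small_expr (e : expr) : bool :=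
  match e with
  | Lit z => Z.abs z <=? 10
  | Reg i => Nat.ltb i nregs
  | Bin _ e1 e2 => small_expr e1 && small_expr e2
  end.

(** Decided by computation for the concrete expressions of the program, and enough for one cost
    bound that is valid for all of them. *)
Definition good_expr (e : expr) : bool := small_expr e && Nat.leb (esize e) 40.

Lemma get_map_seq (g : nat -> Z) len i :
  (i < len)%nat -> get (map g (seq 0 len)) i = g i.
Proof.
  intros Hi. unfold get.
  rewrite (nth_indep _ 0 (g 0%nat)) by (rewrite length_map, length_seq; lia).
  rewrite map_nth, seq_nth by lia. reflexivity.
Qed.

Lemma put_map_seq (g : nat -> Z) v len : forall a i,
  (i < len)%nat ->
  put (map g (seq a len)) i v = map (updr g (a + i) v) (seq a len).
Proof.
  induction len as [|len IH]; intros a i Hi; [lia|].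
  cbn [seq map]. destruct i as [|i]; cbn [put].
  - unfold updr at 1. rewrite Nat.add_0_r, Nat.eqb_refl. f_equal.
    apply map_ext_in. intros j Hj. apply in_seq in Hj. unfold updr.
    destruct (Nat.eqb_spec a j); [lia|reflexivity].
  - rewrite IH by lia. f_equal.
    + unfold updr. destruct (Nat.eqb_spec (a + S i) a); [lia|reflexivity].
    + replace (a + S i)%nat with (S a + i)%nat by lia. reflexivity.
Qed.

Lemma get_cells L m a :
  0 <= a < Z.of_nat L -> get (cells L m) (Z.to_nat a) = m a.
Proof.
  intros Ha. unfold cells.
  rewrite (get_map_seq (fun a => m (Z.of_nat a))) by lia. f_equal. lia.
Qed.

Lemma put_cells L m a v :
  0 <= a < Z.of_nat L -> put (cells L m) (Z.to_nat a) v = cells L (updm m a v).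
Proof.
  intros Ha. unfold cells.
  rewrite (put_map_seq (fun a => m (Z.of_nat a))) by lia.
  apply map_ext. intros j. unfold updr, updm.
  destruct (Nat.eqb_spec (0 + Z.to_nat a) j), (Z.eqb_spec a (Z.of_nat j));
    lia || reflexivity.
Qed.

Lemma set_reg_st L f m i v :
  (i < nregs)%nat -> set_reg (st L f m) i v = st L (updr f i v) m.
Proof.
  intros Hi. unfold set_reg, st. cbn [regs mem]. f_equal. now apply put_map_seq.
Qed.

Lemma set_mem_st L f m a v :
  0 <= a < Z.of_nat L -> set_mem (st L f m) a v = st L f (updm m a v).
Proof.
  intros Ha. unfold set_mem, st. cbn [regs mem]. f_equal. now apply put_cells.
Qed.

Lemma eval_st L f m e : small_expr e = true -> eval (st L f m) e = evalf f e.
Proof.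
  induction e as [z|i|o e1 IH1 e2 IH2]; cbn [small_expr eval evalf]; intros He.
  - reflexivity.
  - apply Nat.ltb_lt in He. now apply get_map_seq.
  - apply andb_prop in He as [H1 H2]. now rewrite IH1, IH2.
Qed.

(** * Time and space from a bound on the contents of the cells *)

Definition bnd (lb : nat) : Z := 2 ^ Z.of_nat lb.

(** The factor 4000 leaves room for the two expressions of a [Store], each of cost at most
    [1600 * lb + 80]. *)
Definition step_time (lb : nat) : Z := 4000 * (Z.of_nat lb + 1).

Definition space_bound (lb L : nat) : nat := (nregs + L) * (lb + 2).

Definition bounded_regs (lb : nat) (f : nat -> Z) : Prop :=
  forall i, (i < nregs)%nat -> Z.abs (f i) <= bnd lb.

Definition bounded_mem (lb L : nat) (m : Z -> Z) : Prop :=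
  forall a, 0 <= a < Z.of_nat L -> Z.abs (m a) <= bnd lb.

Lemma bits_le k z : Z.abs z <= 2 ^ Z.of_nat k -> (bits z <= k + 2)%nat.
Proof.
  intros Hz. unfold bits.
  enough (Z.log2 (Z.abs z) <= Z.of_nat k) by lia.
  rewrite <- (Z.log2_pow2 (Z.of_nat k)) by lia. now apply Z.log2_le_mono.
Qed.

Lemma list_bits_le k l :
  (forall z, In z l -> Z.abs z <= 2 ^ Z.of_nat k) ->
  (list_bits l <= length l * (k + 2))%nat.
Proof.
  unfold list_bits. induction l as [|z l IH]; intros H; [cbn; lia|].
  change (bits z + list_sum (map bits l) <= S (length l) * (k + 2))%nat.
  assert (bits z <= k + 2)%nat by (apply bits_le, H; now left).
  assert (list_sum (map bits l) <= length l * (k + 2))%nat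
    by (apply IH; intros; apply H; now right).
  lia.
Qed.

Lemma space_st lb L f m :
  bounded_regs lb f -> bounded_mem lb L m ->
  (space (st L f m) <= space_bound lb L)%nat.
Proof.
  intros Hf Hm. unfold space, st, space_bound. cbn [regs mem].
  pose proof (list_bits_le lb (map f (seq 0 nregs))) as H1.
  pose proof (list_bits_le lb (cells L m)) as H2.
  unfold cells in *. rewrite length_map, length_seq in H1, H2.
  enough (list_bits (map f (seq 0 nregs)) <= nregs * (lb + 2) /\
          list_bits (map (fun a => m (Z.of_nat a)) (seq 0 L)) <= L * (lb + 2))%nat
    by lia.
  split; [apply H1|apply H2]; intros z Hz; apply in_map_iff in Hz as (i & <- & Hi);
    apply in_seq in Hi; [apply Hf|apply Hm]; lia.
Qed.

(** For bounds of at least 2 the product dominates the sum, so one bound serves for all operations.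
    Division by zero gives [0], and the remainder modulo zero is the dividend. *)
Lemma eval_op_bound o a b A B :
  2 <= A -> 2 <= B -> Z.abs a <= A -> Z.abs b <= B -> Z.abs (eval_op o a b) <= A * B.
Proof.
  intros HA HB Ha Hb.
  assert (A + B <= A * B) by nia.
  destruct o; cbn [eval_op].
  - lia.
  - lia.
  - rewrite Z.abs_mul. apply Z.mul_le_mono_nonneg; lia.
  - destruct (Z.eq_dec b 0) as [->|Hb0]; [rewrite Zdiv_0_r; lia|].
    assert (Z.abs (a / b) <= Z.abs a); [|nia].
    pose proof (Z.div_mod a b Hb0) as E.
    destruct (Z.lt_trichotomy b 0) as [Hb1|[Hb1|Hb1]]; [|lia|].
    + pose proof (Z.mod_neg_bound a b Hb1). nia.
    + pose proof (Z.mod_pos_bound a b Hb1). nia.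
  - destruct (Z.eq_dec b 0) as [->|Hb0]; [rewrite Zmod_0_r; lia|].
    destruct (Z.lt_trichotomy b 0) as [Hb1|[Hb1|Hb1]]; [|lia|].
    + pose proof (Z.mod_neg_bound a b Hb1). lia.
    + pose proof (Z.mod_pos_bound a b Hb1). lia.
  - destruct (a <? b); cbn; lia.
  - destruct (a =? b); cbn; lia.
Qed.

Lemma bnd_ge16 lb : (4 <= lb)%nat -> 16 <= bnd lb.
Proof.
  intros H. unfold bnd. change 16 with (2 ^ 4). apply Z.pow_le_mono_r; lia.
Qed.

(** Multiplying the bounds of the operands adds the exponents, hence [lb * esize e]. The premise
    [4 <= lb] makes room for the literals, which are at most 10 in absolute value. *)
Lemma evalf_bound lb f e :
  (4 <= lb)%nat -> bounded_regs lb f -> small_expr e = true ->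
  Z.abs (evalf f e) <= 2 ^ Z.of_nat (lb * esize e).
Proof.
  intros Hlb Hf. pose proof (bnd_ge16 lb Hlb) as Hb. unfold bnd in Hb.
  assert (E2 : forall k, (1 <= k)%nat -> 2 <= 2 ^ Z.of_nat (lb * k)).
  { intros k Hk. change 2 with (2 ^ 1) at 1. apply Z.pow_le_mono_r; nia. }
  assert (E1 : forall e', (1 <= esize e')%nat) by (intros []; cbn [esize]; lia).
  induction e as [z|i|o e1 IH1 e2 IH2]; cbn [small_expr evalf esize]; intros He.
  - apply Z.leb_le in He. rewrite Nat.mul_1_r. lia.
  - apply Nat.ltb_lt in He. rewrite Nat.mul_1_r. now apply Hf.
  - apply andb_prop in He as [H1 H2].
    eapply Z.le_trans;
      [apply eval_op_bound; [| |apply IH1, H1|apply IH2, H2]; apply E2, E1|].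
    rewrite <- Z.pow_add_r by lia. apply Z.pow_le_mono_r; lia.
Qed.

(** Each of the [esize e] nodes is charged for a value of at most [lb * esize e + 2] bits. *)
Lemma cost_bound lb L f m e :
  (4 <= lb)%nat -> bounded_regs lb f -> small_expr e = true ->
  (cost (st L f m) e <= esize e * (lb * esize e + 2))%nat.
Proof.
  intros Hlb Hf.
  assert (B : forall e, small_expr e = true ->
                (bits (eval (st L f m) e) <= lb * esize e + 2)%nat).
  { intros e' He. rewrite eval_st by easy. now apply bits_le, evalf_bound. }
  induction e as [z|i|o e1 IH1 e2 IH2]; intros He.
  - specialize (B _ He). cbn [cost esize] in *. lia.
  - specialize (B _ He). cbn [cost esize] in *. lia.
  - specialize (B _ He). cbn [small_expr] in He.
    apply andb_prop in He as [H1 H2]. specialize (IH1 H1). specialize (IH2 H2).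
    cbn [cost]. cbn [esize] in *.
    set (a := esize e1) in *. set (b := esize e2) in *.
    assert (a * (lb * a) + b * (lb * b) <= (a + b) * (lb * (a + b + 1)))%nat by nia.
    lia.
Qed.

(** The constants are [40 * 40] and [40 * 2], from the limit of 40 nodes. *)
Lemma good_cost lb L f m e :
  (4 <= lb)%nat -> bounded_regs lb f -> good_expr e = true ->
  (cost (st L f m) e <= 1600 * lb + 80)%nat.
Proof.
  intros Hlb Hf He. apply andb_prop in He as [H1 H2]. apply Nat.leb_le in H2.
  pose proof (cost_bound lb L f m e Hlb Hf H1).
  assert (lb * esize e <= lb * 40)%nat by nia. nia.
Qed.

Lemma good_small e : good_expr e = true -> small_expr e = true.
Proof. intros H. now apply andb_prop in H. Qed.

Lemma bounded_updr lb f i v :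
  bounded_regs lb f -> Z.abs v <= bnd lb -> bounded_regs lb (updr f i v).
Proof.
  intros Hf Hv j Hj. unfold updr. destruct (Nat.eqb i j); [easy|now apply Hf].
Qed.

Lemma bounded_updm lb L m a v :
  bounded_mem lb L m -> Z.abs v <= bnd lb -> bounded_mem lb L (updm m a v).
Proof.
  intros Hm Hv j Hj. unfold updm. destruct (a =? j); [easy|now apply Hm].
Qed.

(** * Total correctness with a step count *)

Lemma step_time_pos lb : 0 < step_time lb.
Proof. unfold step_time. lia. Qed.

Section Triples.

Context (lb L : nat) (Hlb : (4 <= lb)%nat).

(** A Hoare triple for total correctness. Time is counted in units of [step_time lb]. The bounds on
    the cells are carried along as premises and conclusions, so specifications need not mention
    them; [L] is fixed, hence all writes stay inside the memory. *)
Definition tri (c : cmd) (f : nat -> Z) (m : Z -> Z) (k : Z)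
    (Q : (nat -> Z) -> (Z -> Z) -> Prop) : Prop :=
  bounded_regs lb f -> bounded_mem lb L m ->
  exists f' m' t u,
    exec c (st L f m) (st L f' m') t u /\
    Z.of_nat t <= k * step_time lb /\ (u <= space_bound lb L)%nat /\
    bounded_regs lb f' /\ bounded_mem lb L m' /\ Q f' m'.

(** Gives access to the cell bounds hidden in [tri], for values that are known to be bounded only
    because they were found in a cell. *)
Lemma tri_bounded c f m k Q :
  (bounded_regs lb f -> bounded_mem lb L m -> tri c f m k Q) -> tri c f m k Q.
Proof using lb L. clear Hlb. intros H Hf Hm. now apply H. Qed.

Lemma tri_conseq c f m k k' (Q Q' : (nat -> Z) -> (Z -> Z) -> Prop) :
  tri c f m k Q -> k <= k' -> (forall f' m', Q f' m' -> Q' f' m') -> tri c f m k' Q'.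
Proof using lb L. clear Hlb.
  intros H Hk HQ Hf Hm.
  destruct (H Hf Hm) as (f' & m' & t & u & He & Ht & Hu & Hf' & Hm' & HQ').
  exists f', m', t, u. repeat split; auto.
  pose proof (step_time_pos lb). nia.
Qed.

Lemma tri_skip f m k (Q : (nat -> Z) -> (Z -> Z) -> Prop) :
  1 <= k -> Q f m -> tri Skip f m k Q.
Proof using lb L. clear Hlb.
  intros Hk HQ Hf Hm. exists f, m, 1%nat, (space (st L f m)).
  split; [constructor|]. repeat split; auto using space_st.
  unfold step_time. nia.
Qed.

Lemma tri_assign i e f m k (Q : (nat -> Z) -> (Z -> Z) -> Prop) :
  1 <= k -> good_expr e = true -> Nat.ltb i nregs = true ->
  Z.abs (evalf f e) <= bnd lb ->
  Q (updr f i (evalf f e)) m -> tri (Assign i e) f m k Q.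
Proof.
  intros Hk He Hi Hv HQ Hf Hm. apply Nat.ltb_lt in Hi.
  pose proof (exec_assign (st L f m) i e) as Hex. cbv zeta in Hex.
  rewrite (eval_st L f m e (good_small e He)), set_reg_st in Hex by easy.
  do 4 eexists. split; [exact Hex|].
  pose proof (bounded_updr lb f i _ Hf Hv).
  pose proof (good_cost lb L f m e Hlb Hf He).
  repeat split; auto.
  - unfold step_time. nia.
  - apply Nat.max_lub; now apply space_st.
Qed.

Lemma tri_fetch i e f m k (Q : (nat -> Z) -> (Z -> Z) -> Prop) :
  1 <= k -> good_expr e = true -> Nat.ltb i nregs = true ->
  0 <= evalf f e < Z.of_nat L ->
  Q (updr f i (m (evalf f e))) m -> tri (Fetch i e) f m k Q.
Proof.
  intros Hk He Hi Ha HQ Hf Hm. apply Nat.ltb_lt in Hi.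
  pose proof (exec_fetch (st L f m) i e) as Hex. cbv zeta in Hex.
  rewrite (eval_st L f m e (good_small e He)) in Hex.
  change (mem (st L f m)) with (cells L m) in Hex.
  rewrite get_cells, set_reg_st in Hex by easy.
  do 4 eexists. split; [exact Hex|].
  assert (Hv : Z.abs (m (evalf f e)) <= bnd lb) by now apply Hm.
  pose proof (bounded_updr lb f i _ Hf Hv).
  pose proof (good_cost lb L f m e Hlb Hf He).
  pose proof (bits_le lb _ Hv).
  repeat split; auto.
  - unfold step_time. nia.
  - apply Nat.max_lub; now apply space_st.
Qed.

Lemma tri_store e1 e2 f m k (Q : (nat -> Z) -> (Z -> Z) -> Prop) :
  1 <= k -> good_expr e1 = true -> good_expr e2 = true ->
  0 <= evalf f e1 < Z.of_nat L -> Z.abs (evalf f e2) <= bnd lb ->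
  Q f (updm m (evalf f e1) (evalf f e2)) -> tri (Store e1 e2) f m k Q.
Proof.
  intros Hk He1 He2 Ha Hv HQ Hf Hm.
  pose proof (exec_store (st L f m) e1 e2) as Hex. cbv zeta in Hex.
  rewrite (eval_st L f m e1 (good_small e1 He1)) in Hex.
  rewrite (eval_st L f m e2 (good_small e2 He2)) in Hex.
  rewrite set_mem_st in Hex by easy.
  do 4 eexists. split; [exact Hex|].
  pose proof (bounded_updm lb L m (evalf f e1) _ Hm Hv).
  pose proof (good_cost lb L f m e1 Hlb Hf He1).
  pose proof (good_cost lb L f m e2 Hlb Hf He2).
  repeat split; auto.
  - unfold step_time. nia.
  - apply Nat.max_lub; now apply space_st.
Qed.

Lemma tri_seq c1 c2 f m k1 k (Q1 Q : (nat -> Z) -> (Z -> Z) -> Prop) :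
  tri c1 f m k1 Q1 ->
  (forall f' m', Q1 f' m' -> tri c2 f' m' (k - k1) Q) ->
  tri (Seq c1 c2) f m k Q.
Proof using lb L. clear Hlb.
  intros H1 H2 Hf Hm.
  destruct (H1 Hf Hm) as (f1 & m1 & t1 & u1 & He1 & Ht1 & Hu1 & Hf1 & Hm1 & HQ1).
  destruct (H2 f1 m1 HQ1 Hf1 Hm1)
    as (f2 & m2 & t2 & u2 & He2 & Ht2 & Hu2 & Hf2 & Hm2 & HQ2).
  exists f2, m2, (t1 + t2)%nat, (Nat.max u1 u2).
  split; [econstructor; eassumption|]. repeat split; auto; lia.
Qed.

Lemma tri_assign_seq i e c f m k Q :
  good_expr e = true -> Nat.ltb i nregs = true ->
  Z.abs (evalf f e) <= bnd lb ->
  tri c (updr f i (evalf f e)) m (k - 1) Q -> tri (Seq (Assign i e) c) f m k Q.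
Proof.
  intros He Hi Hv H.
  apply tri_seq with (k1 := 1)
    (Q1 := fun f' m' => f' = updr f i (evalf f e) /\ m' = m).
  - apply tri_assign; auto. lia.
  - intros f' m' [-> ->]. exact H.
Qed.

Lemma tri_fetch_seq i e c f m k Q :
  good_expr e = true -> Nat.ltb i nregs = true ->
  0 <= evalf f e < Z.of_nat L ->
  tri c (updr f i (m (evalf f e))) m (k - 1) Q -> tri (Seq (Fetch i e) c) f m k Q.
Proof.
  intros He Hi Hv H.
  apply tri_seq with (k1 := 1)
    (Q1 := fun f' m' => f' = updr f i (m (evalf f e)) /\ m' = m).
  - apply tri_fetch; auto. lia.
  - intros f' m' [-> ->]. exact H.
Qed.

Lemma tri_store_seq e1 e2 c f m k Q :
  good_expr e1 = true -> good_expr e2 = true ->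
  0 <= evalf f e1 < Z.of_nat L -> Z.abs (evalf f e2) <= bnd lb ->
  tri c f (updm m (evalf f e1) (evalf f e2)) (k - 1) Q ->
  tri (Seq (Store e1 e2) c) f m k Q.
Proof.
  intros He1 He2 Ha Hv H.
  apply tri_seq with (k1 := 1)
    (Q1 := fun f' m' => f' = f /\ m' = updm m (evalf f e1) (evalf f e2)).
  - apply tri_store; auto. lia.
  - intros f' m' [-> ->]. exact H.
Qed.

Lemma tri_if e c1 c2 f m k Q :
  good_expr e = true ->
  (evalf f e <> 0 -> tri c1 f m (k - 1) Q) ->
  (evalf f e = 0 -> tri c2 f m (k - 1) Q) ->
  tri (If e c1 c2) f m k Q.
Proof.
  intros He H1 H2 Hf Hm.
  pose proof (good_cost lb L f m e Hlb Hf He) as Hc.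
  pose proof (eval_st L f m e (good_small e He)) as Ev.
  destruct (Z.eq_dec (evalf f e) 0) as [E|E].
  - destruct (H2 E Hf Hm) as (f' & m' & t & u & Hex & Ht & Hrest).
    exists f', m', (cost (st L f m) e + t)%nat, u.
    split; [apply exec_if_false; congruence|].
    split; [|exact Hrest]. unfold step_time in *. lia.
  - destruct (H1 E Hf Hm) as (f' & m' & t & u & Hex & Ht & Hrest).
    exists f', m', (cost (st L f m) e + t)%nat, u.
    split; [apply exec_if_true; congruence|].
    split; [|exact Hrest]. unfold step_time in *. lia.
Qed.

(** The index of [I] bounds the number of rounds to come; the loop may stop while it is still
    positive, as happens in the merge and in the climb to the root. A round costs the body and one
    test, and the final test adds 1. *)
Lemma tri_while e c (I : Z -> (nat -> Z) -> (Z -> Z) -> Prop) kb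
    (Q : (nat -> Z) -> (Z -> Z) -> Prop) (j : Z) f m k :
  good_expr e = true -> 0 <= kb ->
  (forall i f m, 0 <= i -> I i f m -> evalf f e <> 0 ->
     0 < i /\ tri c f m kb (I (i - 1))) ->
  (forall i f m, 0 <= i -> I i f m -> evalf f e = 0 -> Q f m) ->
  0 <= j -> I j f m -> j * (kb + 1) + 1 <= k ->
  tri (While e c) f m k Q.
Proof.
  intros He Hkb Hbody Hend Hj HI Hk.
  apply tri_conseq with (k := j * (kb + 1) + 1) (Q := Q); [|lia|auto].
  clear k Hk. revert f m HI. pattern j. apply natlike_ind; [| |exact Hj]; clear j Hj.
  - intros f m HI Hf Hm.
    pose proof (good_cost lb L f m e Hlb Hf He) as Hc.
    pose proof (eval_st L f m e (good_small e He)) as Ev.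
    destruct (Z.eq_dec (evalf f e) 0) as [E|E].
    + exists f, m, (cost (st L f m) e), (space (st L f m)).
      split; [apply exec_while_false; congruence|].
      repeat split; auto using space_st.
      * unfold step_time. lia.
      * eapply Hend; [|exact HI|exact E]. lia.
    + destruct (Hbody 0 f m ltac:(lia) HI E). lia.
  - intros j Hj IH f m HI Hf Hm.
    pose proof (good_cost lb L f m e Hlb Hf He) as Hc.
    pose proof (eval_st L f m e (good_small e He)) as Ev.
    destruct (Z.eq_dec (evalf f e) 0) as [E|E].
    + exists f, m, (cost (st L f m) e), (space (st L f m)).
      split; [apply exec_while_false; congruence|].
      repeat split; auto using space_st.
      * unfold step_time. nia.
      * eapply Hend; [|exact HI|exact E]. lia.
    + destruct (Hbody (Z.succ j) f m ltac:(lia) HI E) as [_ Hb].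
      destruct (Hb Hf Hm) as (f1 & m1 & t1 & u1 & He1 & Ht1 & Hu1 & Hf1 & Hm1 & HI1).
      replace (Z.succ j - 1) with j in HI1 by lia.
      destruct (IH f1 m1 HI1 Hf1 Hm1)
        as (f2 & m2 & t2 & u2 & He2 & Ht2 & Hu2 & Hf2 & Hm2 & HQ).
      exists f2, m2, (cost (st L f m) e + t1 + t2)%nat, (Nat.max u1 u2).
      split; [eapply exec_while_true; [congruence|eassumption|eassumption]|].
      repeat split; auto; [|lia].
      unfold step_time in *. nia.
Qed.

End Triples.

(** * Signed subset sums *)

Fixpoint wsum (g : Z -> Z) (s : Z) (len : nat) : Z :=
  match len with O => 0 | S l => g s + wsum g (s + 1) l end.

(** The base-3 digits of [c], shifted to [-1, 0, 1], are the coefficients. *)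
Fixpoint digit_sum (y : Z -> Z) (s : Z) (len : nat) (c : Z) : Z :=
  match len with
  | O => 0
  | S l => (c mod 3 - 1) * y s + digit_sum y (s + 1) l (c / 3)
  end.

Definition trit (e : Z) : Prop := -1 <= e <= 1.

Lemma wsum_ext g h s len :
  (forall p, s <= p < s + Z.of_nat len -> g p = h p) -> wsum g s len = wsum h s len.
Proof.
  revert s. induction len as [|len IH]; intros s H; [reflexivity|]. cbn [wsum].
  rewrite H by lia. rewrite IH; [reflexivity|]. intros p Hp. apply H. lia.
Qed.

Lemma wsum_app g a b s : wsum g s (a + b) = wsum g s a + wsum g (s + Z.of_nat a) b.
Proof.
  revert s. induction a as [|a IH]; intros s.
  - cbn [wsum Nat.add]. now rewrite Z.add_0_r.
  - cbn [wsum Nat.add]. rewrite IH. replace (s + 1 + Z.of_nat a) with (s + Z.of_nat (S a)) by lia.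
    lia.
Qed.

Lemma wsum_plus g h s len : wsum (fun p => g p + h p) s len = wsum g s len + wsum h s len.
Proof.
  revert s. induction len as [|len IH]; intros s; [reflexivity|].
  cbn [wsum]. rewrite IH. lia.
Qed.

Lemma wsum_opp g s len : wsum (fun p => - g p) s len = - wsum g s len.
Proof.
  revert s. induction len as [|len IH]; intros s; [reflexivity|].
  cbn [wsum]. rewrite IH. lia.
Qed.

Lemma wsum_nonneg g s len : (forall p, 0 <= g p) -> 0 <= wsum g s len.
Proof.
  intros H. revert s. induction len as [|len IH]; intros s; [cbn; lia|].
  cbn [wsum]. specialize (H s). specialize (IH (s + 1)). lia.
Qed.

Lemma wsum_point x i s len :
  wsum (fun p => Z.b2z (p =? i) * x p) s len =
  if ((s <=? i) && (i <? s + Z.of_nat len))%bool then x i else 0.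
Proof.
  revert s. induction len as [|len IH]; intros s.
  - cbn [wsum]. destruct (Z.leb_spec s i), (Z.ltb_spec i (s + Z.of_nat 0));
      cbn [andb]; lia.
  - cbn [wsum]. rewrite IH.
    destruct (Z.eqb_spec s i) as [->|Hn].
    + destruct (Z.leb_spec (i + 1) i); [lia|].
      destruct (Z.leb_spec i i); [|lia].
      destruct (Z.ltb_spec i (i + Z.of_nat (S len))); [|lia]. cbn [andb Z.b2z]. lia.
    + destruct (Z.leb_spec (s + 1) i), (Z.leb_spec s i),
        (Z.ltb_spec i (s + 1 + Z.of_nat len)), (Z.ltb_spec i (s + Z.of_nat (S len)));
        cbn [andb Z.b2z]; lia.
Qed.

Lemma wsum_sub_le g s len s' len' :
  (forall p, 0 <= g p) -> s <= s' -> s' + Z.of_nat len' <= s + Z.of_nat len ->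
  wsum g s' len' <= wsum g s len.
Proof.
  intros Hg H1 H2.
  set (a := Z.to_nat (s' - s)). set (b := (len - a - len')%nat).
  replace len with (a + (len' + b))%nat by lia. rewrite !wsum_app.
  replace (s + Z.of_nat a) with s' by lia.
  pose proof (wsum_nonneg g s a Hg). pose proof (wsum_nonneg g (s' + Z.of_nat len') b Hg).
  lia.
Qed.

(** The values of [digit_sum] are exactly the signed sums of the block: this direction serves
    soundness of the search, [wsum_digit_sum] serves completeness. *)
Lemma digit_sum_wsum y s len c :
  exists eps, (forall p, trit (eps p)) /\
    digit_sum y s len c = wsum (fun p => eps p * y p) s len.
Proof.
  revert s c. induction len as [|len IH]; intros s c.
  - exists (fun _ => 0). split; [intros; unfold trit; lia|reflexivity].
  - destruct (IH (s + 1) (c / 3)) as (eps & He & E).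
    exists (fun p => if p =? s then c mod 3 - 1 else eps p). split.
    + intros p. destruct (p =? s); [|apply He].
      pose proof (Z.mod_pos_bound c 3). unfold trit. lia.
    + cbn [digit_sum wsum]. rewrite Z.eqb_refl, E. f_equal.
      apply wsum_ext. intros p Hp. destruct (Z.eqb_spec p s); [lia|reflexivity].
Qed.

Lemma wsum_digit_sum y eps s len :
  (forall p, trit (eps p)) ->
  exists c, 0 <= c < 3 ^ Z.of_nat len /\
    digit_sum y s len c = wsum (fun p => eps p * y p) s len.
Proof.
  intros He. revert s. induction len as [|len IH]; intros s.
  - exists 0. split; [cbn; lia|reflexivity].
  - destruct (IH (s + 1)) as (c & Hc & E). specialize (He s). unfold trit in He.
    exists (eps s + 1 + c * 3). rewrite Nat2Z.inj_succ, Z.pow_succ_r by lia.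
    split; [lia|]. cbn [digit_sum wsum].
    rewrite Z.mod_add, Z.div_add, Z.mod_small, Z.div_small by lia.
    rewrite Z.add_0_l, E. lia.
Qed.

Lemma digit_sum_bound y x s len c :
  (forall p, Z.abs (y p) <= x p) -> Z.abs (digit_sum y s len c) <= wsum x s len.
Proof.
  intros H. revert s c. induction len as [|len IH]; intros s c; [cbn; lia|].
  cbn [digit_sum wsum]. specialize (IH (s + 1) (c / 3)). specialize (H s).
  pose proof (Z.mod_pos_bound c 3 ltac:(lia)).
  assert (Z.abs ((c mod 3 - 1) * y s) <= Z.abs (y s)) by nia. lia.
Qed.

(** * Equal subset sums as signed sums over positions *)

Definition at_pos (X : list Z) (p : Z) : Z := nth (Z.to_nat p) X 0.

Lemma wsum_Zsum g s len :
  wsum g (Z.of_nat s) len = Zsum (map (fun k => g (Z.of_nat k)) (seq s len)).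
Proof.
  revert s. induction len as [|len IH]; intros s; [reflexivity|].
  cbn [wsum seq map Zsum fold_right].
  replace (Z.of_nat s + 1) with (Z.of_nat (S s)) by lia. rewrite IH. reflexivity.
Qed.

Lemma Zsum_perm l l' : Permutation l l' -> Zsum l = Zsum l'.
Proof. induction 1; cbn [Zsum fold_right] in *; unfold Zsum in *; cbn; lia. Qed.

Lemma map_at_pos X : map (fun k => at_pos X (Z.of_nat k)) (seq 0 (length X)) = X.
Proof.
  apply nth_ext with (d := 0) (d' := 0); [now rewrite length_map, length_seq|].
  intros i Hi. rewrite length_map, length_seq in Hi.
  pose proof (get_map_seq (fun k => at_pos X (Z.of_nat k)) (length X) i Hi) as E.
  unfold get in E. rewrite E. unfold at_pos. now rewrite Nat2Z.id.
Qed.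

Lemma Zsum_trit_split (e x : nat -> Z) l :
  (forall k, trit (e k)) ->
  Zsum (map (fun k => e k * x k) l) =
  Zsum (map x (filter (fun k => e k =? 1) l)) -
  Zsum (map x (filter (fun k => e k =? -1) l)).
Proof.
  intros He. induction l as [|k l IH]; [reflexivity|].
  cbn [map filter]. specialize (He k). unfold trit in He. unfold Zsum in *.
  cbn [fold_right]. rewrite IH.
  destruct (Z.eqb_spec (e k) 1), (Z.eqb_spec (e k) (-1)); cbn [map fold_right];
    try lia; replace (e k) with 0 by lia; lia.
Qed.

Definition signed_zero_sum (X : list Z) : Prop :=
  exists (eps : Z -> Z) (i j : Z),
    (forall p, trit (eps p)) /\
    0 <= i < Z.of_nat (length X) /\ 0 <= j < Z.of_nat (length X) /\
    eps i = 1 /\ eps j = -1 /\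
    wsum (fun p => eps p * at_pos X p) 0 (length X) = 0.

Lemma NoDup_positions X l :
  NoDup X -> NoDup l -> (forall k, In k l -> (k < length X)%nat) ->
  NoDup (map (fun k => at_pos X (Z.of_nat k)) l).
Proof.
  intros HX Hl Hb. apply NoDup_map_NoDup_ForallPairs; [|exact Hl].
  intros a b Ha Hb' E. unfold at_pos in E. rewrite !Nat2Z.id in E.
  eapply (proj1 (NoDup_nth X 0)); eauto.
Qed.

(** Distinct positions hold distinct integers, so the positions of sign [1] and those of sign [-1]
    yield disjoint sets of values without repetition. *)
Lemma signed_zero_sum_equal X : NoDup X -> signed_zero_sum X -> equal_subset_sum X.
Proof.
  intros HX (eps & i & j & Ht & Hi & Hj & Ei & Ej & E).
  set (x := fun k => at_pos X (Z.of_nat k)).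
  set (sel := fun v => filter (fun k => eps (Z.of_nat k) =? v) (seq 0 (length X))).
  assert (Hsel : forall v k, In k (sel v) <-> (k < length X)%nat /\ eps (Z.of_nat k) = v).
  { intros v k. unfold sel. rewrite filter_In, in_seq, Z.eqb_eq. intuition lia. }
  assert (Hincl : forall v, incl (map x (sel v)) X).
  { intros v z Hz. apply in_map_iff in Hz as (k & <- & Hk). apply Hsel in Hk as [Hk _].
    unfold x, at_pos. rewrite Nat2Z.id. now apply nth_In. }
  assert (Hnd : forall v, NoDup (map x (sel v))).
  { intros v. apply NoDup_positions; [exact HX|apply NoDup_filter, seq_NoDup|].
    intros k Hk. now apply Hsel in Hk. }
  assert (Hne : forall v k, 0 <= k < Z.of_nat (length X) -> eps k = v ->
                            map x (sel v) <> []).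
  { intros v k Hk Ek Hn. apply map_eq_nil in Hn.
    assert (Hin : In (Z.to_nat k) (sel v)).
    { apply Hsel. rewrite Z2Nat.id by lia. split; [lia|exact Ek]. }
    rewrite Hn in Hin. destruct Hin. }
  exists (map x (sel 1)), (map x (sel (-1))).
  repeat split; eauto.
  - intros z H1 H2. apply in_map_iff in H1 as (a & Ea & Ha).
    apply in_map_iff in H2 as (b & Eb & Hb).
    apply Hsel in Ha as [Ha Ha']. apply Hsel in Hb as [Hb Hb'].
    unfold x, at_pos in Ea, Eb. rewrite Nat2Z.id in Ea, Eb.
    assert (a = b) by (eapply (proj1 (NoDup_nth X 0)); eauto; congruence). subst b. congruence.
  - change 0 with (Z.of_nat 0) in E. rewrite wsum_Zsum in E.
    pose proof (Zsum_trit_split (fun k => eps (Z.of_nat k)) x (seq 0 (length X))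
                  (fun k => Ht (Z.of_nat k))) as S.
    unfold sel. fold x in E. unfold x in S at 1. cbv beta in S. lia.
Qed.

Lemma equal_signed_zero_sum X : NoDup X -> equal_subset_sum X -> signed_zero_sum X.
Proof.
  intros HX (A & B & HA & HB & IA & IB & NA & NB & D & E).
  set (ind := fun (A : list Z) z => if in_dec Z.eq_dec z A then 1 else 0).
  assert (Hsum : forall A, NoDup A -> incl A X ->
            Zsum (map (fun z => ind A z * z) X) = Zsum A).
  { clear -HX. intros A HA IA.
    (* [A] may list its members in any order; the filtered [X] is a permutation of it, since both
       are free of duplicates. *)
    transitivity (Zsum (filter (fun z => ind A z =? 1) X)).
    - clear HX IA. induction X as [|z X IH]; [reflexivity|]. cbn [map filter].
      unfold Zsum in *. cbn [fold_right]. rewrite IH.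
      assert (ind A z = 0 \/ ind A z = 1)
        by (unfold ind; destruct (in_dec Z.eq_dec z A); lia).
      destruct (Z.eqb_spec (ind A z) 1); cbn [fold_right]; nia.
    - apply Zsum_perm, NoDup_Permutation; [now apply NoDup_filter|exact HA|].
      intros z. rewrite filter_In, Z.eqb_eq. unfold ind.
      destruct (in_dec Z.eq_dec z A); split; intros; intuition (auto; lia). }
  assert (Hpos : forall z, In z X ->
            exists k, 0 <= k < Z.of_nat (length X) /\ at_pos X k = z).
  { intros z Hz. apply (In_nth X z 0) in Hz as (k & Hk & Ek).
    exists (Z.of_nat k). split; [lia|]. unfold at_pos. now rewrite Nat2Z.id. }
  destruct A as [|a A']; [easy|]. destruct B as [|b B']; [easy|].
  set (A := a :: A') in *. set (B := b :: B') in *.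
  destruct (Hpos a) as (i & Hi & Ei); [apply IA; now left|].
  destruct (Hpos b) as (j & Hj & Ej); [apply IB; now left|].
  exists (fun p => ind A (at_pos X p) - ind B (at_pos X p)), i, j.
  assert (Ha : ~ In a B) by (apply D; now left).
  assert (Hb : ~ In b A) by (intros H; apply (D b H); now left).
  split; [|split; [exact Hi|split; [exact Hj|split; [|split]]]].
  - intros p. unfold ind, trit.
    destruct (in_dec _ _ A), (in_dec _ _ B); lia.
  - rewrite Ei. unfold ind.
    destruct (in_dec _ _ A) as [_|H]; [|destruct H; now left].
    destruct (in_dec _ _ B); [easy|lia].
  - rewrite Ej. unfold ind.
    destruct (in_dec _ _ B) as [_|H]; [|destruct H; now left].
    destruct (in_dec _ _ A); [easy|lia].
  - rewrite wsum_ext with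
      (h := fun p => ind A (at_pos X p) * at_pos X p + - (ind B (at_pos X p) * at_pos X p))
      by (intros; lia).
    rewrite wsum_plus, wsum_opp. change 0 with (Z.of_nat 0) at 1 2.
    rewrite !wsum_Zsum.
    rewrite <- (map_map (fun k => at_pos X (Z.of_nat k)) (fun z => ind A z * z)).
    rewrite <- (map_map (fun k => at_pos X (Z.of_nat k)) (fun z => ind B z * z)).
    rewrite map_at_pos, !Hsum by assumption. lia.
Qed.

(** * Splitting the positions into four blocks and a guessed rest *)

(** For [i <> j] the weights at [i] and [j] vanish, so digits there have no effect: a forced
    position may lie in any block or in the guessed part, without a case distinction. *)
Definition unforced (X : list Z) (i j p : Z) : Z :=
  at_pos X p * (1 - Z.b2z (p =? i) - Z.b2z (p =? j)).

(** Coordinate [i] is forced into the one set and [j] into the other; [g] encodes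
    the choice for the coordinates from [4 * q] on. *)
Definition guess_base (X : list Z) (q : nat) (i j g : Z) : Z :=
  at_pos X i - at_pos X j +
  digit_sum (unforced X i j) (4 * Z.of_nat q) (length X - 4 * q) g.

Definition guess_works (X : list Z) (q : nat) (i j g : Z) : Prop :=
  exists c1 c2 c3 c4 : Z,
    0 <= c1 < 3 ^ Z.of_nat q /\ 0 <= c2 < 3 ^ Z.of_nat q /\
    0 <= c3 < 3 ^ Z.of_nat q /\ 0 <= c4 < 3 ^ Z.of_nat q /\
    guess_base X q i j g
      + digit_sum (unforced X i j) 0 q c1
      + digit_sum (unforced X i j) (Z.of_nat q) q c2 =
    digit_sum (unforced X i j) (2 * Z.of_nat q) q c3
      + digit_sum (unforced X i j) (3 * Z.of_nat q) q c4.

Lemma wsum_blocks g q n :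
  (4 * q <= n)%nat ->
  wsum g 0 n =
  wsum g 0 q + wsum g (Z.of_nat q) q + wsum g (2 * Z.of_nat q) q
  + wsum g (3 * Z.of_nat q) q + wsum g (4 * Z.of_nat q) (n - 4 * q).
Proof.
  intros H. replace n with (q + (q + (q + (q + (n - 4 * q)))))%nat at 1 by lia.
  rewrite !wsum_app, !Z.add_0_l.
  replace (Z.of_nat q + Z.of_nat q) with (2 * Z.of_nat q) by lia.
  replace (2 * Z.of_nat q + Z.of_nat q) with (3 * Z.of_nat q) by lia.
  replace (3 * Z.of_nat q + Z.of_nat q) with (4 * Z.of_nat q) by lia. lia.
Qed.

(** On the right the entries of [eps] at [i] and [j] are free, which makes the sum accessible to
    digit codes of whole blocks. *)
Lemma wsum_forced X eps i j :
  i <> j -> 0 <= i < Z.of_nat (length X) -> 0 <= j < Z.of_nat (length X) ->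
  wsum (fun p => (if p =? i then 1 else if p =? j then -1 else eps p) * at_pos X p)
    0 (length X) =
  at_pos X i - at_pos X j + wsum (fun p => eps p * unforced X i j p) 0 (length X).
Proof.
  intros Hij Hi Hj.
  rewrite wsum_ext with (h := fun p =>
    Z.b2z (p =? i) * at_pos X p + - (Z.b2z (p =? j) * at_pos X p)
    + eps p * unforced X i j p).
  - rewrite !wsum_plus, wsum_opp, !wsum_point.
    destruct (Z.leb_spec 0 i), (Z.leb_spec 0 j),
      (Z.ltb_spec i (0 + Z.of_nat (length X))), (Z.ltb_spec j (0 + Z.of_nat (length X)));
      cbn [andb]; lia.
  - intros p Hp. unfold unforced.
    destruct (Z.eqb_spec p i), (Z.eqb_spec p j); cbn [Z.b2z]; lia.
Qed.

Lemma guess_complete X q :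
  (4 * q <= length X)%nat -> signed_zero_sum X ->
  exists i j g, 0 <= i < Z.of_nat (length X) /\ 0 <= j < Z.of_nat (length X) /\
    0 <= g < 3 ^ Z.of_nat (length X - 4 * q) /\ i <> j /\ guess_works X q i j g.
Proof.
  intros Hq (eps & i & j & Ht & Hi & Hj & Ei & Ej & E).
  assert (Hij : i <> j) by (intros ->; lia).
  (* The third and fourth blocks stand on the other side of the equation, so their codes represent
     [- eps]. *)
  assert (Ht' : forall p, trit (- eps p)) by (intros p; specialize (Ht p); unfold trit in *; lia).
  assert (E' : at_pos X i - at_pos X j
               + wsum (fun p => eps p * unforced X i j p) 0 (length X) = 0).
  { rewrite <- wsum_forced by assumption. etransitivity; [|exact E]. apply wsum_ext. intros p Hp.
    destruct (Z.eqb_spec p i), (Z.eqb_spec p j); subst; congruence. }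
  rewrite (wsum_blocks _ q) in E' by exact Hq.
  destruct (wsum_digit_sum (unforced X i j) eps (4 * Z.of_nat q) (length X - 4 * q) Ht)
    as (g & Hg & Eg).
  destruct (wsum_digit_sum (unforced X i j) eps 0 q Ht) as (c1 & H1 & E1).
  destruct (wsum_digit_sum (unforced X i j) eps (Z.of_nat q) q Ht) as (c2 & H2 & E2).
  destruct (wsum_digit_sum (unforced X i j) (fun p => - eps p) (2 * Z.of_nat q) q Ht')
    as (c3 & H3 & E3).
  destruct (wsum_digit_sum (unforced X i j) (fun p => - eps p) (3 * Z.of_nat q) q Ht')
    as (c4 & H4 & E4).
  exists i, j, g. repeat (split; [assumption|]). exists c1, c2, c3, c4.
  repeat (split; [assumption|]).
  unfold guess_base. rewrite Eg, E1, E2, E3, E4.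
  rewrite (wsum_ext (fun p => - eps p * unforced X i j p)
             (fun p => - (eps p * unforced X i j p)) (2 * Z.of_nat q)) by (intros; lia).
  rewrite (wsum_ext (fun p => - eps p * unforced X i j p)
             (fun p => - (eps p * unforced X i j p)) (3 * Z.of_nat q)) by (intros; lia).
  rewrite !wsum_opp. lia.
Qed.

Lemma guess_sound X q i j g :
  (4 * q <= length X)%nat ->
  0 <= i < Z.of_nat (length X) -> 0 <= j < Z.of_nat (length X) -> i <> j ->
  guess_works X q i j g -> signed_zero_sum X.
Proof.
  intros Hq Hi Hj Hij (c1 & c2 & c3 & c4 & _ & _ & _ & _ & E).
  unfold guess_base in E. set (y := unforced X i j) in *.
  destruct (digit_sum_wsum y (4 * Z.of_nat q) (length X - 4 * q) g) as (e5 & T5 & E5).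
  destruct (digit_sum_wsum y 0 q c1) as (e1 & T1 & E1).
  destruct (digit_sum_wsum y (Z.of_nat q) q c2) as (e2 & T2 & E2).
  destruct (digit_sum_wsum y (2 * Z.of_nat q) q c3) as (e3 & T3 & E3).
  destruct (digit_sum_wsum y (3 * Z.of_nat q) q c4) as (e4 & T4 & E4).
  rewrite E5, E1, E2, E3, E4 in E. clear E5 E1 E2 E3 E4.
  set (eps := fun p =>
    if p <? Z.of_nat q then e1 p else if p <? 2 * Z.of_nat q then e2 p
    else if p <? 3 * Z.of_nat q then - e3 p else if p <? 4 * Z.of_nat q then - e4 p
    else e5 p).
  assert (Heps : forall p, trit (eps p)).
  { intros p. unfold eps.
    specialize (T1 p); specialize (T2 p); specialize (T3 p); specialize (T4 p);
      specialize (T5 p); unfold trit in *.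
    destruct (_ <? _); [lia|]. destruct (_ <? _); [lia|]. destruct (_ <? _); [lia|].
    destruct (_ <? _); lia. }
  exists (fun p => if p =? i then 1 else if p =? j then -1 else eps p), i, j.
  split; [|split; [exact Hi|split; [exact Hj|split; [|split]]]].
  - intros p. specialize (Heps p). unfold trit in *.
    destruct (p =? i); [lia|]. destruct (p =? j); lia.
  - now rewrite Z.eqb_refl.
  - rewrite Z.eqb_refl. destruct (Z.eqb_spec j i); congruence.
  - rewrite wsum_forced by assumption. rewrite (wsum_blocks _ q) by exact Hq. fold y.
    rewrite (wsum_ext (fun p => eps p * y p) (fun p => e1 p * y p) 0).
    2:{ intros p Hp. unfold eps. destruct (Z.ltb_spec p (Z.of_nat q)); lia. }
    rewrite (wsum_ext (fun p => eps p * y p) (fun p => e2 p * y p) (Z.of_nat q)).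
    2:{ intros p Hp. unfold eps. destruct (Z.ltb_spec p (Z.of_nat q)); [lia|].
        destruct (Z.ltb_spec p (2 * Z.of_nat q)); lia. }
    rewrite (wsum_ext (fun p => eps p * y p) (fun p => - (e3 p * y p)) (2 * Z.of_nat q)).
    2:{ intros p Hp. unfold eps. destruct (Z.ltb_spec p (Z.of_nat q)); [lia|].
        destruct (Z.ltb_spec p (2 * Z.of_nat q)); [lia|].
        destruct (Z.ltb_spec p (3 * Z.of_nat q)); lia. }
    rewrite (wsum_ext (fun p => eps p * y p) (fun p => - (e4 p * y p)) (3 * Z.of_nat q)).
    2:{ intros p Hp. unfold eps. destruct (Z.ltb_spec p (Z.of_nat q)); [lia|].
        destruct (Z.ltb_spec p (2 * Z.of_nat q)); [lia|].
        destruct (Z.ltb_spec p (3 * Z.of_nat q)); [lia|].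
        destruct (Z.ltb_spec p (4 * Z.of_nat q)); lia. }
    rewrite (wsum_ext (fun p => eps p * y p) (fun p => e5 p * y p) (4 * Z.of_nat q)).
    2:{ intros p Hp. unfold eps. destruct (Z.ltb_spec p (Z.of_nat q)); [lia|].
        destruct (Z.ltb_spec p (2 * Z.of_nat q)); [lia|].
        destruct (Z.ltb_spec p (3 * Z.of_nat q)); [lia|].
        destruct (Z.ltb_spec p (4 * Z.of_nat q)); [lia|reflexivity]. }
    rewrite !wsum_opp. lia.
Qed.

Lemma equal_subset_sum_guess X q :
  NoDup X -> (4 * q <= length X)%nat ->
  equal_subset_sum X <->
  exists i j g, 0 <= i < Z.of_nat (length X) /\ 0 <= j < Z.of_nat (length X) /\
    0 <= g < 3 ^ Z.of_nat (length X - 4 * q) /\ i <> j /\ guess_works X q i j g.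
Proof.
  intros HX Hq. split.
  - intros H. now apply guess_complete, equal_signed_zero_sum.
  - intros (i & j & g & Hi & Hj & _ & Hij & Hg).
    apply signed_zero_sum_equal; [exact HX|]. now apply (guess_sound X q i j g).
Qed.

(** * Tournament trees *)

(** [skip] is the one node whose equation may fail while an update climbs; [0] is no node, so
    [min_nodes N t 0] means a valid tree. The array of [2 * N - 1] nodes works for every [N], not
    only for powers of two. *)
Definition min_nodes (N : Z) (t : Z -> Z) (skip : Z) : Prop :=
  forall j, 1 <= j < N -> j <> skip -> t j = Z.min (t (2 * j)) (t (2 * j + 1)).

(** Induction along the path [j], [j / 2], ... to the root. *)
Lemma root_le N t j : min_nodes N t 0 -> 1 <= j < 2 * N -> t 1 <= t j.
Proof.
  intros Ht Hj. assert (H0 : 0 <= j) by lia. revert Hj. pattern j. apply Z_lt_induction; [|lia].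
  clear j H0. intros j IH Hj.
  destruct (Z.eq_dec j 1) as [->|Hj1]; [lia|].
  pose proof (Z.div_mod j 2 ltac:(lia)). pose proof (Z.mod_pos_bound j 2 ltac:(lia)).
  specialize (IH (j / 2) ltac:(lia) ltac:(lia)).
  specialize (Ht (j / 2) ltac:(lia) ltac:(lia)).
  assert (j = 2 * (j / 2) \/ j = 2 * (j / 2) + 1) as [E|E] by lia; rewrite E; lia.
Qed.

(** Descend from the root to a child that attains the minimum; [2 * N - j] decreases. *)
Lemma root_leaf N t :
  1 <= N -> min_nodes N t 0 -> exists i, 0 <= i < N /\ t 1 = t (N + i).
Proof.
  intros HN Ht.
  enough (G : forall d, 0 <= d -> forall j, d = 2 * N - j -> 1 <= j < 2 * N ->
            exists i, 0 <= i < N /\ t j = t (N + i)).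
  { apply (G (2 * N - 1)); lia. }
  intros d Hd. pattern d. apply Z_lt_induction; [|lia]. clear d Hd.
  intros d IH j Ed Hj.
  destruct (Z_lt_le_dec j N) as [Hlt|Hge].
  - rewrite (Ht j) by lia.
    destruct (Z.min_spec (t (2 * j)) (t (2 * j + 1))) as [[_ ->]|[_ ->]].
    + apply (IH (2 * N - 2 * j)); lia.
    + apply (IH (2 * N - (2 * j + 1))); lia.
  - exists (j - N). split; [lia|]. f_equal. lia.
Qed.

(** Recomputing node [j] repairs its equation and can damage only that of its parent. For [j = 1]
    the parent index is [0], and the tree is valid again. *)
Lemma min_nodes_step N t j :
  1 <= j -> min_nodes N t j ->
  min_nodes N (updm t j (Z.min (t (2 * j)) (t (2 * j + 1)))) (j / 2).
Proof.
  intros Hj Ht k Hk Hn. unfold updm.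
  pose proof (Z.div_mod j 2 ltac:(lia)). pose proof (Z.mod_pos_bound j 2 ltac:(lia)).
  destruct (Z.eqb_spec j (2 * k)); [lia|]. destruct (Z.eqb_spec j (2 * k + 1)); [lia|].
  destruct (Z.eqb_spec j k) as [->|]; [reflexivity|]. apply Ht; lia.
Qed.

(** A leaf packs the sum [key], the list index [i] and the pointer [u] into one
    integer, so that comparing integers compares the sums first. *)
Definition code (N key i u : Z) : Z := key * (N * (N + 1)) + (i * (N + 1) + u).

Section Code.

Context (N key i u : Z) (Hi : 0 <= i < N) (Hu : 0 <= u <= N).

Lemma code_low : 0 <= i * (N + 1) + u < N * (N + 1).
Proof. nia. Qed.

(** Division rounds down, so this holds for negative sums too. *)
Lemma code_key : code N key i u / (N * (N + 1)) = key.
Proof.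
  pose proof code_low. unfold code.
  rewrite Z.add_comm, Z.div_add by lia. rewrite Z.div_small by lia. lia.
Qed.

Lemma code_leaf : (code N key i u mod (N * (N + 1))) / (N + 1) = i.
Proof.
  pose proof code_low. unfold code.
  rewrite Z.add_comm, Z.mod_add by lia. rewrite Z.mod_small by lia.
  rewrite Z.add_comm, Z.div_add by lia. rewrite Z.div_small by lia. lia.
Qed.

Lemma code_pos : code N key i u mod (N + 1) = u.
Proof.
  unfold code.
  replace (key * (N * (N + 1)) + (i * (N + 1) + u))
    with (u + (key * N + i) * (N + 1)) by ring.
  rewrite Z.mod_add by lia. apply Z.mod_small. lia.
Qed.

End Code.

(** [p i] is the pointer of list [i] into the values [b]. The summand [a i] is present only inside
    the packed leaf and has no cell of its own. *)
Definition leaves (N : Z) (a b t p : Z -> Z) : Prop :=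
  forall i, 0 <= i < N -> 0 <= p i <= N /\ t (N + i) = code N (a i + b (p i)) i (p i).

(** The least code carries a least sum because division by [N * (N + 1)] is monotone; ties are
    broken by list index and pointer. *)
Lemma tree_root N a b t p :
  1 <= N -> min_nodes N t 0 -> leaves N a b t p ->
  exists i, 0 <= i < N /\ 0 <= p i <= N /\ t 1 = code N (a i + b (p i)) i (p i) /\
    forall k, 0 <= k < N -> a i + b (p i) <= a k + b (p k).
Proof.
  intros HN Ht Hl. destruct (root_leaf N t HN Ht) as (i & Hi & Ei).
  destruct (Hl i Hi) as [Hp El]. exists i.
  split; [lia|]. split; [lia|]. split; [congruence|]. intros k Hk. destruct (Hl k Hk) as [Hp' El'].
  pose proof (root_le N t (N + k) Ht ltac:(lia)) as Hle.
  rewrite Ei, El, El' in Hle.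
  rewrite <- (code_key N (a i + b (p i)) i (p i)),
    <- (code_key N (a k + b (p k)) k (p k)) by lia.
  apply Z.div_le_mono; nia.
Qed.

(** * Sorted tables *)

(** The distinct values [v c] in increasing order, padded with [big]. *)
Definition table (N big : Z) (v b : Z -> Z) : Prop :=
  (forall u, 0 <= u <= N -> b u = big \/ exists c, 0 <= c < N /\ b u = v c) /\
  (forall u w, 0 <= u <= w -> w <= N -> b u <= b w) /\
  (forall c, 0 <= c < N -> exists u, 0 <= u <= N /\ b u = v c) /\
  b N = big.

(** [big] stands for the absence of a larger value. With the number of codes scanned so far in place
    of [N], this is also the invariant of the scan. *)
Definition next_above (N big : Z) (v : Z -> Z) (last cur : Z) : Prop :=
  (cur = big \/ exists c, 0 <= c < N /\ cur = v c /\ last < cur) /\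
  (forall c, 0 <= c < N -> last < v c -> cur <= v c).

(** Strict increase up to the padding is what the counting argument in [partial_table_full] relies
    on. *)
Definition partial_table (N big : Z) (v b : Z -> Z) (k last : Z) : Prop :=
  (forall u, 0 <= u < k -> b u = big \/ exists c, 0 <= c < N /\ b u = v c) /\
  (forall u w, 0 <= u < w -> w < k -> b u < b w \/ b w = big) /\
  (forall c, 0 <= c < N -> v c <= last -> exists u, 0 <= u < k /\ b u = v c) /\
  (0 < k -> last = b (k - 1)).

Lemma partial_table_step N big v b b' k last cur :
  (forall c, 0 <= c < N -> v c < big) ->
  0 <= k -> partial_table N big v b k last -> next_above N big v last cur ->
  b' k = cur -> (forall u, 0 <= u < k -> b' u = b u) ->
  partial_table N big v b' (k + 1) cur.
Proof.
  intros Hv Hk (T1 & T2 & T3 & T4) (N1 & N2) Ek Eb.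
  split; [|split; [|split]].
  - intros u Hu. destruct (Z.eq_dec u k) as [->|].
    + rewrite Ek. destruct N1 as [|(c & Hc & E & _)]; eauto.
    + rewrite Eb by lia. apply T1. lia.
  - intros u w Hu Hw. destruct (Z.eq_dec w k) as [->|].
    + rewrite Ek, Eb by lia. destruct N1 as [|(c & Hc & E & Hl)]; [auto|left].
      specialize (T4 ltac:(lia)).
      destruct (Z.eq_dec u (k - 1)) as [->|]; [lia|].
      destruct (T2 u (k - 1)) as [|E2]; [lia|lia|lia|].
      specialize (Hv c Hc). lia.
    + rewrite !Eb by lia. apply T2; lia.
  - intros c Hc Hle. destruct (Z_le_gt_dec (v c) last) as [H|H].
    + destruct (T3 c Hc H) as (u & Hu & E). exists u. rewrite Eb by lia. lia.
    + exists k. specialize (N2 c Hc ltac:(lia)). lia.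
  - intros _. now replace (k + 1 - 1) with k by lia.
Qed.

Lemma partial_table_full N big v b last :
  0 <= N -> (forall c, 0 <= c < N -> v c < big) ->
  partial_table N big v b (N + 1) last -> table N big v b.
Proof.
  intros HN Hv (T1 & T2 & T3 & T4).
  assert (Hle : forall u, 0 <= u <= N -> b u <= big).
  { intros u Hu. destruct (T1 u) as [|(c & Hc & E)]; [lia|lia|].
    specialize (Hv c Hc). lia. }
  (* Pigeonhole: otherwise the [N + 1] entries would be pairwise distinct and all among the [N]
     values [v c]. *)
  assert (EN : b N = big).
  { destruct (Z.eq_dec (b N) big) as [|Hne]; [assumption|exfalso].
    set (bs := map (fun k => b (Z.of_nat k)) (seq 0 (S (Z.to_nat N)))).
    set (vs := map (fun k => v (Z.of_nat k)) (seq 0 (Z.to_nat N))).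
    assert (Hnb : forall u, 0 <= u <= N -> b u <> big).
    { intros u Hu. destruct (Z.eq_dec u N) as [->|]; [exact Hne|].
      destruct (T2 u N) as [|]; [lia|lia| |lia]. specialize (Hle N ltac:(lia)). lia. }
    assert (Hnd : NoDup bs).
    { apply NoDup_map_NoDup_ForallPairs; [|apply seq_NoDup].
      intros x y Hx Hy E. apply in_seq in Hx, Hy.
      destruct (Nat.lt_trichotomy x y) as [Hlt|[Heq|Hlt]]; [|exact Heq|].
      - destruct (T2 (Z.of_nat x) (Z.of_nat y)) as [|H]; [lia|lia|lia|].
        apply Hnb in H; lia.
      - destruct (T2 (Z.of_nat y) (Z.of_nat x)) as [|H]; [lia|lia|lia|].
        apply Hnb in H; lia. }
    assert (Hin : incl bs vs).
    { intros z Hz. apply in_map_iff in Hz as (x & <- & Hx). apply in_seq in Hx.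
      destruct (T1 (Z.of_nat x)) as [H|(c & Hc & E)]; [lia|apply Hnb in H; lia|].
      rewrite E. apply in_map_iff. exists (Z.to_nat c).
      rewrite Z2Nat.id, in_seq by lia. split; [reflexivity|lia]. }
    pose proof (NoDup_incl_length Hnd Hin) as Hlen.
    unfold bs, vs in Hlen. rewrite !length_map, !length_seq in Hlen. lia. }
  split; [|split; [|split; [|exact EN]]].
  - intros u Hu. apply T1. lia.
  - intros u w Hu Hw. destruct (Z.eq_dec u w) as [->|]; [lia|].
    destruct (T2 u w) as [|E]; [lia|lia|lia|]. specialize (Hle u ltac:(lia)). lia.
  - intros c Hc. destruct (T3 c Hc) as (u & Hu & E).
    + rewrite T4 by lia. replace (N + 1 - 1) with N by lia.
      specialize (Hv c Hc). lia.
    + exists u. lia.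
Qed.

(** * Merging two streams of sums *)

(** No sum [a i + b u] already consumed from the first stream ([u < p i]) occurs
    anywhere in the second one. *)
Definition separated (N : Z) (a b p a' b' : Z -> Z) : Prop :=
  forall i u k l, 0 <= i < N -> 0 <= u < p i -> 0 <= k < N -> 0 <= l <= N ->
    a i + b u <> a' k + b' l.

(** The dropped sum is below all current sums of the other stream, hence by monotonicity of [b']
    below those to come; the ones already dropped there match nothing in this stream, by the
    symmetric invariant. *)
Lemma separated_advance N a b p a' b' p' i :
  separated N a b p a' b' -> separated N a' b' p' a b ->
  (forall u w, 0 <= u <= w -> w <= N -> b' u <= b' w) ->
  0 <= i < N -> 0 <= p i <= N -> (forall k, 0 <= k < N -> 0 <= p' k) ->
  (forall k, 0 <= k < N -> a i + b (p i) < a' k + b' (p' k)) ->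
  separated N a b (updm p i (p i + 1)) a' b'.
Proof.
  intros S S' Hb Hi Hp Hp' Hlt x u k l Hx Hu Hk Hl.
  unfold updm in Hu. destruct (Z.eqb_spec i x) as [<-|]; [|now apply S].
  destruct (Z.eq_dec u (p i)) as [->|]; [|apply S; lia].
  destruct (Z_lt_le_dec l (p' k)) as [Hl'|Hl'].
  - apply not_eq_sym, S'; lia.
  - specialize (Hlt k Hk). specialize (Hb (p' k) l). specialize (Hp' k Hk). lia.
Qed.

(** Potential of the merge: each step raises it by 1 in one of the streams, and it never exceeds
    [N * N]. *)
Fixpoint total (p : Z -> Z) (k : nat) : Z :=
  match k with O => 0 | S k => p (Z.of_nat k) + total p k end.

Lemma total_le p M k :
  (forall i, 0 <= i < Z.of_nat k -> p i <= M) -> total p k <= Z.of_nat k * M.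
Proof.
  induction k as [|k IH]; intros H; [cbn; lia|]. cbn [total].
  assert (total p k <= Z.of_nat k * M) by (apply IH; intros; apply H; lia).
  specialize (H (Z.of_nat k) ltac:(lia)). nia.
Qed.

Lemma total_updm p i v k :
  0 <= i -> total (updm p i v) k = total p k + (if i <? Z.of_nat k then v - p i else 0).
Proof.
  intros Hi. induction k as [|k IH]; [destruct (Z.ltb_spec i (Z.of_nat 0)); cbn; lia|].
  cbn [total]. rewrite IH. unfold updm at 1.
  destruct (Z.eqb_spec i (Z.of_nat k)) as [E|], (Z.ltb_spec i (Z.of_nat k)),
    (Z.ltb_spec i (Z.of_nat (S k))); try lia.
  rewrite <- E. lia.
Qed.

(** * The program *)

Section Program.

Declare Scope expr_scope.
Delimit Scope expr_scope with expr.
Bind Scope expr_scope with expr.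
Local Coercion Reg : nat >-> expr.
Local Coercion Lit : Z >-> expr.
Local Notation "a + b" := (Bin Defs.Add a b) : expr_scope.
Local Notation "a - b" := (Bin Sub a b) : expr_scope.
Local Notation "a * b" := (Bin Mul a b) : expr_scope.
Local Notation "a / b" := (Bin Div a b) : expr_scope.
Local Notation "a 'mod' b" := (Bin Mod a b) : expr_scope.
Local Notation "a < b" := (Bin Defs.Lt a b) : expr_scope.
Local Notation "a =? b" := (Bin Defs.Eq a b) : expr_scope.
Local Notation "r ::= e" := (Assign r e) (at level 60).
Local Notation "c ;; d" := (Seq c d) (at level 61, right associativity).

(** The input occupies the memory cells below [n].  Each of the two streams of sums
    owns a region that starts at [rbase]: [N + 1] cells for its sorted table, then
    [2 * N] cells for its tournament tree, where node [j] has the children [2 * j] and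
    [2 * j + 1] and the leaves are the nodes from [N] on (cell 0 is not used). *)

Local Notation rn := 0%nat.
Local Notation rS := 1%nat.
Local Notation rq := 2%nat.
Local Notation rN := 3%nat.
Local Notation rH := 4%nat.
Local Notation rR := 5%nat.
Local Notation rG := 6%nat.
Local Notation ri := 7%nat.
Local Notation rj := 8%nat.
Local Notation rt := 9%nat.
Local Notation rbase := 10%nat.
Local Notation rs0 := 11%nat.
Local Notation rans := 12%nat.
Local Notation racc := 13%nat.
Local Notation re := 14%nat.
Local Notation rs := 15%nat.
Local Notation rx := 16%nat.
Local Notation rk := 17%nat.
Local Notation rlast := 18%nat.
Local Notation rcur := 19%nat.
Local Notation rc := 20%nat.
Local Notation ru := 21%nat.
Local Notation rv := 22%nat.
Local Notation rjj := 23%nat.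
Local Notation ra := 24%nat.
Local Notation rb := 25%nat.
Local Notation rlen := 26%nat.
Local Notation rP := 27%nat.

(** Signed sums are computed anew from the input whenever they are needed; this costs a polynomial
    factor in time and saves storing any unsorted list. *)
Definition eval_cmd : cmd :=
  racc ::= 0 ;;
  While (0 < rlen)
    (Fetch rx rs ;;
     racc ::= racc + (re mod 3 - 1) * (rx * (1 - (rs =? ri) - (rs =? rj))) ;;
     re ::= re / 3 ;;
     rs ::= rs + 1 ;;
     rlen ::= rlen - 1).

(** With [H] the sum of the squares of the input, [10 * H + 1] serves as infinity:
    it exceeds [5 * H], which bounds every sum of the search, even after adding a
    value of absolute value at most [4 * H]. *)
Definition next_cmd : cmd :=
  rcur ::= 10 * rH + 1 ;;
  rc ::= 0 ;;
  While (rc < rN)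
    (re ::= rc ;;
     rs ::= rs0 + rq ;;
     rlen ::= rq ;;
     eval_cmd ;;
     If ((rlast < racc) * (racc < rcur)) (rcur ::= racc) Skip ;;
     rc ::= rc + 1).

(** The starting value of [rlast] lies below every signed sum, so the first pass finds the least
    one. *)
Definition table_cmd : cmd :=
  rlast ::= 0 - (10 * rH + 1) ;;
  rk ::= 0 ;;
  While (rk < rN + 1)
    (next_cmd ;;
     Store (rbase + rk) rcur ;;
     rlast ::= rcur ;;
     rk ::= rk + 1).

Definition min_cmd : cmd :=
  Fetch ra (rbase + rN + 1 + 2 * rjj) ;;
  Fetch rb (rbase + rN + 1 + (2 * rjj + 1)) ;;
  Store (rbase + rN + 1 + rjj) (rb + (ra < rb) * (ra - rb)).

(** Nodes are filled from the last to the first, so both children are ready when their minimum is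
    taken. *)
Definition tree_cmd : cmd :=
  rjj ::= 2 * rN - 1 ;;
  While (0 < rjj)
    (If (rjj < rN)
       min_cmd
       (re ::= rjj - rN ;;
        rs ::= rs0 ;;
        rlen ::= rq ;;
        eval_cmd ;;
        Fetch rb rbase ;;
        Store (rbase + rN + 1 + rjj)
          ((rt + racc + rb) * rP + (rjj - rN) * (rN + 1))) ;;
     rjj ::= rjj - 1).

Definition build_cmd : cmd := table_cmd ;; tree_cmd.

(** The first address is that of the root, node 1. Adding [(rb - rx) * rP + 1] to a code replaces
    the value [b] in the sum by its successor and moves the pointer by one, while the list index
    stays. *)
Definition pop_cmd : cmd :=
  Fetch ra (rbase + rN + 2) ;;
  Fetch rx (rbase + ra mod (rN + 1)) ;;
  Fetch rb (rbase + (ra mod (rN + 1) + 1)) ;;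
  rjj ::= rN + ra mod rP / (rN + 1) ;;
  Store (rbase + rN + 1 + rjj) (ra + (rb - rx) * rP + 1) ;;
  While (1 < rjj) (rjj ::= rjj / 2 ;; min_cmd).

(** The addresses are the roots [base + N + 2] of the regions that start at [n] and at
    [n + 3 * N + 1]. *)
Definition keys_cmd : cmd :=
  Fetch ra (rn + rN + 2) ;;
  ru ::= ra / rP ;;
  Fetch ra (rn + 4 * rN + 3) ;;
  rv ::= ra / rP.

(** A least sum beyond [5 * H] means that the stream has only padded sums left, so no match can
    follow. *)
Definition merge_cmd : cmd :=
  keys_cmd ;;
  While ((ru < 5 * rH + 1) * (rv < 5 * rH + 1) * (1 - (ru =? rv)))
    (If (ru < rv) (rbase ::= rn) (rbase ::= rn + 3 * rN + 1) ;;
     pop_cmd ;;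
     keys_cmd).

Definition guess_cmd : cmd :=
  re ::= rG / (rn * rn) ;;
  rs ::= 4 * rq ;;
  rlen ::= rn - 4 * rq ;;
  eval_cmd ;;
  Fetch ra ri ;;
  Fetch rb rj ;;
  rt ::= ra - rb + racc ;;
  rbase ::= rn ;;
  rs0 ::= 0 ;;
  build_cmd ;;
  rt ::= 0 ;;
  rbase ::= rn + 3 * rN + 1 ;;
  rs0 ::= 2 * rq ;;
  build_cmd ;;
  merge_cmd ;;
  If ((ru =? rv) * (ru < 5 * rH + 1)) (rans ::= 1) Skip.

(** One counter runs through all triples, [G = i + n * j + n ^ 2 * g]. For [n = 0] its range is
    empty. *)
Definition search_cmd : cmd :=
  rans ::= 0 ;;
  rG ::= 0 ;;
  While (rG < rR)
    (ri ::= rG mod rn ;;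
     rj ::= rG / rn mod rn ;;
     If (ri =? rj) Skip guess_cmd ;;
     rG ::= rG + 1) ;;
  rn ::= rans.

(** The first guard says [4 * (q + 1) <= n] and [3 ^ (q + 1) <= S], so the loop stops at the largest
    admissible [q]. *)
Definition setup_cmd : cmd :=
  rq ::= 0 ;;
  rN ::= 1 ;;
  While ((4 * rq + 3 < rn) * (3 * rN < rS + 1))
    (rN ::= 3 * rN ;;
     rq ::= rq + 1) ;;
  rP ::= rN * (rN + 1) ;;
  rk ::= 0 ;;
  rH ::= 0 ;;
  While (rk < rn)
    (Fetch rx rk ;;
     rH ::= rH + rx * rx ;;
     rk ::= rk + 1) ;;
  rk ::= 4 * rq ;;
  rR ::= rn * rn ;;
  While (rk < rn)
    (rR ::= 3 * rR ;;
     rk ::= rk + 1).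

(** The two writes of [0] change no value; they extend the register list to 31 cells and the memory
    to [n + 6 * N + 2] cells. *)
Definition main_cmd : cmd :=
  30%nat ::= 0 ;;
  setup_cmd ;;
  Store (rn + 6 * rN + 1) 0 ;;
  search_cmd.

(** Membership is a boolean test, so that frame conditions for concrete registers hold by
    computation. *)
Definition frame (l : list nat) (f f' : nat -> Z) : Prop :=
  forall r, existsb (Nat.eqb r) l = false -> f' r = f r.

Lemma frame_refl l f : frame l f f.
Proof. easy. Qed.

Lemma frame_updr l f f' i v :
  frame l f f' -> existsb (Nat.eqb i) l = true -> frame l f (updr f' i v).
Proof.
  intros H Hi r Hr. unfold updr. destruct (Nat.eqb_spec i r) as [->|]; [congruence|].
  now apply H.
Qed.

Lemma frame_trans l l' f f' f'' :
  frame l f f' -> frame l' f' f'' ->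
  forallb (fun i => existsb (Nat.eqb i) l) l' = true -> frame l f f''.
Proof.
  intros H H' Hl r Hr. rewrite H'; [now apply H|].
  destruct (existsb (Nat.eqb r) l') eqn:E; [|reflexivity].
  apply existsb_exists in E as (i & Hi & Ei). apply Nat.eqb_eq in Ei as <-.
  rewrite forallb_forall in Hl. rewrite (Hl r Hi) in Hr. discriminate.
Qed.

Ltac frame_solve :=
  solve [repeat first
    [ apply frame_refl
    | assumption
    | apply frame_updr; [|reflexivity]
    | match goal with
      | H : frame _ ?f1 ?f2 |- frame _ _ ?f2 =>
          eapply (frame_trans _ _ _ f1 f2); [|exact H|reflexivity]
      end ]].

Ltac regs :=
  repeat (cbn [evalf eval_op updr Nat.eqb];
    match goal with
    | H : frame _ _ ?f' |- context [?f' ?r] => rewrite (H r eq_refl)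
    | H : ?f ?r = _ |- context [?f ?r] =>
        match type of f with nat -> Z => is_var f; rewrite H end
    end);
  cbn [evalf eval_op updr Nat.eqb].

Lemma trit_mul_le d z b : trit d -> Z.abs z <= b -> Z.abs (d * z) <= b.
Proof. unfold trit. intros Hd Hz. rewrite Z.abs_mul. nia. Qed.

Lemma abs_le_square z : Z.abs z <= z * z.
Proof. nia. Qed.

Lemma b2z_min a b : b + Z.b2z (a <? b) * (a - b) = Z.min a b.
Proof. destruct (Z.ltb_spec a b); cbn [Z.b2z]; lia. Qed.

Lemma abs_div_le x y : 1 <= y -> Z.abs (x / y) <= Z.abs x.
Proof.
  intros Hy. pose proof (Z.div_mod x y ltac:(lia)) as E.
  pose proof (Z.mod_pos_bound x y ltac:(lia)). nia.
Qed.

Lemma pow3_le_pow2 k : 3 ^ Z.of_nat k <= 2 ^ (2 * Z.of_nat k).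
Proof. rewrite Z.pow_mul_r by lia. apply Z.pow_le_mono_l. lia. Qed.

Lemma pow3_pos k : 1 <= 3 ^ Z.of_nat k.
Proof. assert (0 < 3 ^ Z.of_nat k) by (apply Z.pow_pos_nonneg; lia). lia. Qed.

(** A bound on all signed sums, as [|z| <= z * z] for integers. It takes one multiplication per
    entry and no test of signs, and squaring only doubles the length. *)
Definition square_sum (X : list Z) : Z :=
  wsum (fun p => at_pos X p * at_pos X p) 0 (length X).

Lemma square_sum_nonneg X : 0 <= square_sum X.
Proof. apply wsum_nonneg. intros p. nia. Qed.

Lemma length_put l i v : length (put l i v) = Nat.max (length l) (S i).
Proof.
  revert l. induction i as [|i IH]; intros [|z l]; cbn [put length]; try lia;
    rewrite IH; cbn [length]; lia.
Qed.

Lemma nth_put l i v j : nth j (put l i v) 0 = if Nat.eqb i j then v else nth j l 0.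
Proof.
  revert l j. induction i as [|i IH]; intros [|z l] [|j]; cbn [put nth Nat.eqb];
    try reflexivity.
  - now destruct j.
  - rewrite IH. destruct (Nat.eqb i j); [reflexivity|now destruct j].
  - now rewrite IH.
Qed.

Lemma cells_extend L1 L2 m :
  (L1 < L2)%nat -> (forall a, Z.of_nat L1 <= a -> m a = 0) ->
  put (cells L1 m) (L2 - 1) 0 = cells L2 m.
Proof.
  intros Hl Hm.
  assert (El : forall L, length (cells L m) = L)
    by (intros; unfold cells; now rewrite length_map, length_seq).
  assert (En : forall L j, nth j (cells L m) 0 = if Nat.ltb j L then m (Z.of_nat j) else 0).
  { intros L j. destruct (Nat.ltb_spec j L).
    - unfold cells. now rewrite <- (get_map_seq (fun a => m (Z.of_nat a)) L j) by lia.
    - apply nth_overflow. rewrite El. lia. }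
  apply nth_ext with (d := 0) (d' := 0); [rewrite length_put, !El; lia|].
  intros j Hj. rewrite length_put, El in Hj. rewrite nth_put, !En.
  destruct (Nat.ltb_spec j L2); [|lia].
  destruct (Nat.eqb_spec (L2 - 1) j); [symmetry; apply Hm; lia|].
  destruct (Nat.ltb_spec j L1); [reflexivity|symmetry; apply Hm; lia].
Qed.

(** * The search for a fixed instance, block length and cell bound *)

Section Search.

Context (X : list Z) (qn lb : nat).

Local Notation n := (Z.of_nat (length X)).
Local Notation q := (Z.of_nat qn).
Local Notation N := (3 ^ Z.of_nat qn).
Local Notation P := (N * (N + 1)).

Definition cell_count : nat := (length X + 6 * Z.to_nat N + 2)%nat.

Local Notation SS := (square_sum X).
Local Notation L := cell_count.
Local Notation big := (10 * SS + 1).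

(** [Hcode] makes every packed leaf fit into a cell, [Hguess] the counter of the guesses. *)
Context (Hlb : (4 <= lb)%nat) (Hq : (4 * qn <= length X)%nat)
  (Hcode : (30 * SS + 30) * P <= bnd lb)
  (Hguess : (n + 1) * (n + 1) * 3 ^ Z.of_nat (length X - 4 * qn) <= bnd lb).

Lemma cell_count_eq : Z.of_nat L = n + 6 * N + 2.
Proof. pose proof (pow3_pos qn). unfold cell_count. lia. Qed.

Lemma bnd_facts : 30 * SS + 30 <= bnd lb /\ 30 * N <= bnd lb /\ P <= bnd lb /\
  n * n <= bnd lb /\ 2 * n <= bnd lb /\ 30 <= bnd lb.
Proof.
  pose proof (pow3_pos qn). pose proof (square_sum_nonneg X).
  assert (0 < 3 ^ Z.of_nat (length X - 4 * qn)) by (apply Z.pow_pos_nonneg; lia).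
  repeat split; nia.
Qed.

Lemma unforced_le i j p : Z.abs (unforced X i j p) <= at_pos X p * at_pos X p.
Proof.
  unfold unforced. pose proof (abs_le_square (at_pos X p)).
  assert (Z.abs (1 - Z.b2z (p =? i) - Z.b2z (p =? j)) <= 1)
    by (destruct (p =? i), (p =? j); cbn; lia).
  rewrite Z.abs_mul. nia.
Qed.

Lemma digit_sum_le_square_sum i j s len c :
  0 <= s -> s + Z.of_nat len <= n ->
  Z.abs (digit_sum (unforced X i j) s len c) <= SS.
Proof.
  intros Hs Hl.
  etransitivity; [apply digit_sum_bound, unforced_le|].
  apply wsum_sub_le; [intros; nia|lia|lia].
Qed.

(** * Evaluation of signed sums and sorted tables in memory *)

Definition inputs (m : Z -> Z) : Prop := forall p, 0 <= p < n -> m p = at_pos X p.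

Definition globals (i j : Z) (f : nat -> Z) : Prop :=
  f rn = n /\ f rq = q /\ f rN = N /\ f rH = SS /\ f rP = P /\ f ri = i /\ f rj = j.

Definition locals : list nat :=
  [rS; rR; rG; rt; rbase; rs0; rans; racc; re; rs; rx; rk; rlast; rcur; rc; ru; rv;
   rjj; ra; rb; rlen].

Lemma globals_frame i j f f' : globals i j f -> frame locals f f' -> globals i j f'.
Proof. intros G Hf. unfold globals. now rewrite !Hf by reflexivity. Qed.

Definition eval_time : Z := 6 * n + 3.

Lemma eval_spec f m i j s len c :
  globals i j f -> inputs m -> f re = c -> f rs = s -> f rlen = Z.of_nat len ->
  0 <= s -> s + Z.of_nat len <= n -> 0 <= c ->
  tri lb L eval_cmd f m eval_time (fun f' m' =>
    m' = m /\ frame [racc; re; rs; rx; rlen] f f' /\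
    f' racc = digit_sum (unforced X i j) s len c).
Proof.
  intros (Gn & Gq & GN & GH & GP & Gi & Gj) Hm Ee Es El Hs Hsl Hc.
  pose proof (square_sum_nonneg X). pose proof bnd_facts as (B1 & B2 & B3 & B4 & B5 & B6).
  pose proof cell_count_eq as EL. pose proof (pow3_pos qn).
  set (y := unforced X i j). set (sq := fun p => at_pos X p * at_pos X p).
  apply tri_bounded. intros Hbf _.
  (* The code is the content of a register, so the triple itself provides a bound on it. *)
  assert (Hcb : c <= bnd lb).
  { specialize (Hbf re ltac:(unfold nregs; lia)). rewrite Ee in Hbf. lia. }
  unfold eval_cmd, eval_time.
  apply tri_assign_seq; auto; regs; [lia|].
  (* The bound on [a'] reserves the squares at the positions still to be read, so the accumulator
     never exceeds [SS]. *)
  apply tri_while with (kb := 5) (j := Z.of_nat len)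
    (I := fun l f' m' => m' = m /\ frame [racc; re; rs; rx; rlen] f f' /\
       exists l' s' c' a', l = Z.of_nat l' /\ f' rlen = l /\ f' rs = s' /\ f' re = c' /\
         f' racc = a' /\ 0 <= c' <= c /\ s <= s' /\ s' + l = s + Z.of_nat len /\
         Z.abs a' <= SS - wsum sq s' l' /\
         a' + digit_sum y s' l' c' = digit_sum y s len c); auto; try lia.
  - intros l f' m' Hl (-> & Hfr & l' & s' & c' & a' & -> & E1 & E2 & E3 & E4 &
      Hc' & Hs' & Hsl' & Ha & Hsum)
      Hcond.
    revert Hcond. regs. intros Hcond.
    destruct (Z.ltb_spec 0 (Z.of_nat l')) as [Hl'|]; [|easy].
    split; [lia|].
    destruct l' as [|l']; [lia|]. cbn [wsum digit_sum] in *.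
    pose proof (wsum_nonneg sq (s' + 1) l' ltac:(intros; unfold sq; nia)) as Hw.
    assert (Hy : Z.abs (y s') <= sq s') by apply unforced_le.
    assert (Hcm := Z.mod_pos_bound c' 3 ltac:(lia)).
    assert (Hterm : Z.abs ((c' mod 3 - 1) * y s') <= sq s')
      by (apply trit_mul_le; [unfold trit; lia|exact Hy]).
    assert (Hdiv : 0 <= c' / 3 <= c') by (split; [apply Z.div_pos|apply Z.div_le_upper_bound]; lia).
    apply tri_fetch_seq; auto; regs; [lia|].
    rewrite Hm by lia.
    change (at_pos X s' * (1 - Z.b2z (s' =? i) - Z.b2z (s' =? j))) with (y s').
    apply tri_assign_seq; auto; regs;
    change (at_pos X s' * (1 - Z.b2z (s' =? i) - Z.b2z (s' =? j))) with (y s'); [lia|].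
    apply tri_assign_seq; auto; regs; [lia|].
    apply tri_assign_seq; auto; regs; [lia|].
    apply tri_assign; auto; regs; try lia.
    split; [reflexivity|]. split; [frame_solve|].
    exists l', (s' + 1), (c' / 3), (a' + (c' mod 3 - 1) * y s').
    regs. repeat split; lia.
  - intros l f' m' Hl (-> & Hfr & l' & s' & c' & a' & -> & E1 & E2 & E3 & E4 &
      Hc' & Hs' & Hsl' & Ha & Hsum)
      Hcond.
    revert Hcond. regs. intros Hcond.
    destruct (Z.ltb_spec 0 (Z.of_nat l')) as [Hl'|]; [easy|].
    destruct l'; [|lia]. cbn [wsum digit_sum] in *.
    split; [reflexivity|]. split; [frame_solve|]. lia.
  - split; [reflexivity|]. split; [frame_solve|].
    exists len, s, c, 0. regs. repeat split; try lia.
    rewrite Z.abs_0.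
    enough (wsum sq s len <= SS) by lia.
    apply wsum_sub_le; [intros; unfold sq; nia|lia|lia].
Qed.

Definition next_time : Z := N * (eval_time + 7) + 3.

Lemma next_spec f m i j s0 v last :
  globals i j f -> inputs m -> f rs0 = s0 -> f rlast = last ->
  0 <= s0 -> s0 + 2 * q <= n ->
  (forall c, v c = digit_sum (unforced X i j) (s0 + q) qn c) ->
  tri lb L next_cmd f m next_time (fun f' m' =>
    m' = m /\ frame [racc; re; rs; rx; rlen; rcur; rc] f f' /\
    next_above N big v last (f' rcur)).
Proof.
  intros G Hm Es0 Elast Hs0 Hs0' Ev.
  pose proof (square_sum_nonneg X) as B0. pose proof bnd_facts as (B1 & B2 & B3 & B4 & B5 & B6).
  pose proof (pow3_pos qn) as BN.
  assert (Hv : forall c, Z.abs (v c) <= SS)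
    by (intros c; rewrite Ev; apply digit_sum_le_square_sum; lia).
  pose proof G as (Gn & Gq & GN & GH & GP & Gi & Gj).
  unfold next_cmd, next_time.
  apply tri_assign_seq; auto; regs; [lia|].
  apply tri_assign_seq; auto; regs; [lia|].
  apply tri_while with (kb := eval_time + 6) (j := N)
    (I := fun l f' m' => m' = m /\ frame [racc; re; rs; rx; rlen; rcur; rc] f f' /\
    exists c, l = N - c /\ 0 <= c <= N /\ f' rc = c /\ Z.abs (f' rcur) <= big /\
    next_above c big v last (f' rcur)); auto; try (unfold eval_time; lia).
  - intros l f' m' Hl (-> & Hfr & c & -> & Hc & Ec & Hcur & Hnext).
    regs. intros Hcond.
    destruct (Z.ltb_spec c N) as [Hc'|]; [|easy].
    split; [lia|].
    apply tri_assign_seq; auto; regs; [lia|].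
    apply tri_assign_seq; auto; regs; [lia|].
    apply tri_assign_seq; auto; regs; [lia|].
    eapply tri_seq with (k1 := eval_time).
    { apply eval_spec with (i := i) (j := j) (s := s0 + q) (len := qn) (c := c); auto; try lia.
      apply (globals_frame i j f); [exact G|frame_solve]. }
    intros f1 m1 (-> & Hfr1 & Eacc). rewrite <- Ev in Eacc. specialize (Hv c).
    apply tri_seq with (k1 := 2)
      (Q1 := fun f2 m2 => m2 = m /\ frame [rcur] f1 f2 /\ Z.abs (f2 rcur) <= big /\
    next_above (c + 1) big v last (f2 rcur)).
    + destruct Hnext as [N1 N2].
      apply tri_if; auto; regs; intros Hif.
      * apply tri_assign; auto; regs; try lia.
        split; [reflexivity|]. split; [frame_solve|]. split; [lia|].
        destruct (Z.ltb_spec last (v c)); [|easy].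
        destruct (Z.ltb_spec (v c) (f' rcur)); [|easy].
        split; [right; exists c; lia|].
        intros c0 Hc0 Hl0. destruct (Z.eq_dec c0 c) as [->|]; [lia|].
        specialize (N2 c0 ltac:(lia) Hl0). lia.
      * apply tri_skip; [lia|]. regs.
        split; [reflexivity|]. split; [apply frame_refl|]. split; [exact Hcur|]. split.
        -- destruct N1 as [|(c0 & Hc0 & E & Hl0)]; [now left|right; exists c0].
           repeat split; lia.
        -- intros c0 Hc0 Hl0. destruct (Z.eq_dec c0 c) as [->|]; [|apply N2; lia].
           destruct (Z.ltb_spec last (v c)); [|lia].
           destruct (Z.ltb_spec (v c) (f' rcur)); [easy|lia].
    + intros f2 m2 (-> & Hfr2 & Hcur2 & Hnext2).
      apply tri_assign; auto; regs; try lia.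
      split; [reflexivity|]. split; [frame_solve|].
      exists (c + 1). regs. repeat (split; [lia|]). exact Hnext2.
  - intros l f' m' Hl (-> & Hfr & c & -> & Hc & Ec & Hcur & Hnext).
    regs. intros Hcond.
    destruct (Z.ltb_spec c N) as [Hc'|]; [easy|].
    replace c with N in Hnext by lia. auto.
  - split; [reflexivity|]. split; [frame_solve|].
    exists 0. regs. do 4 (split; [lia|]). split; [now left|lia].
Qed.

Definition same_outside (m m' : Z -> Z) (lo hi : Z) : Prop :=
  forall a, a < lo \/ hi <= a -> m' a = m a.

Lemma inputs_outside m m' lo hi :
  inputs m -> same_outside m m' lo hi -> n <= lo -> inputs m'.
Proof. intros Hm Hs Hlo p Hp. rewrite Hs by lia. now apply Hm. Qed.

Definition table_time : Z := (N + 1) * (next_time + 4) + 3.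

Lemma table_spec f m i j s0 base v :
  globals i j f -> inputs m -> f rs0 = s0 -> f rbase = base ->
  0 <= s0 -> s0 + 2 * q <= n -> n <= base -> base + 3 * N + 1 <= Z.of_nat L ->
  (forall c, v c = digit_sum (unforced X i j) (s0 + q) qn c) ->
  tri lb L table_cmd f m table_time (fun f' m' =>
    same_outside m m' base (base + N + 1) /\
    frame [racc; re; rs; rx; rlen; rlast; rk; rcur; rc] f f' /\
    table N big v (fun u => m' (base + u))).
Proof.
  intros G Hm Es0 Ebase Hs0 Hs0' Hb Hb' Ev.
  pose proof (square_sum_nonneg X) as B0. pose proof bnd_facts as (B1 & B2 & B3 & B4 & B5 & B6).
  pose proof (pow3_pos qn) as BN.
  assert (Hv : forall c, Z.abs (v c) <= SS)
    by (intros c; rewrite Ev; apply digit_sum_le_square_sum; lia).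
  assert (Hv' : forall c, 0 <= c < N -> v c < big) by (intros c _; specialize (Hv c); lia).
  pose proof G as (Gn & Gq & GN & GH & GP & Gi & Gj).
  unfold table_cmd, table_time.
  apply tri_assign_seq; auto; regs; [lia|].
  apply tri_assign_seq; auto; regs; [lia|].
  apply tri_while with (kb := next_time + 3) (j := N + 1)
    (I := fun l f' m' => same_outside m m' base (base + N + 1) /\
    frame [racc; re; rs; rx; rlen; rlast; rk; rcur; rc] f f' /\
    exists k, l = N + 1 - k /\ 0 <= k <= N + 1 /\ f' rk = k /\
    partial_table N big v (fun u => m' (base + u)) k (f' rlast));
    auto; try (unfold next_time, eval_time; lia).
  - intros l f' m' Hl (Hout & Hfr & k & -> & Hk & Ek & Hpart).
    regs. intros Hcond.
    destruct (Z.ltb_spec k (N + 1)) as [Hk'|]; [|easy].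
    split; [lia|].
    eapply tri_seq with (k1 := next_time).
    { apply next_spec with (i := i) (j := j) (s0 := s0) (v := v) (last := f' rlast); auto.
      - apply (globals_frame i j f); [exact G|frame_solve].
      - eapply inputs_outside; eauto.
      - now regs. }
    intros f1 m1 (-> & Hfr1 & Hnext).
    assert (Hcur : Z.abs (f1 rcur) <= big).
    { destruct Hnext as [[E|(c & Hc & E & _)] _]; [lia|]. specialize (Hv c). lia. }
    apply tri_store_seq; auto; regs; [lia|lia|].
    apply tri_assign_seq; auto; regs; [lia|].
    apply tri_assign; auto; regs; try lia.
    split; [|split; [frame_solve|]].
    { intros a Ha. unfold updm. destruct (Z.eqb_spec (base + k) a); [lia|]. now apply Hout. }
    exists (k + 1). regs. repeat (split; [lia|]).
    eapply partial_table_step; [exact Hv'|lia|exact Hpart|exact Hnext| |].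
    + unfold updm. now rewrite Z.eqb_refl.
    + intros u Hu. unfold updm. destruct (Z.eqb_spec (base + k) (base + u)); [lia|reflexivity].
  - intros l f' m' Hl (Hout & Hfr & k & -> & Hk & Ek & Hpart).
    regs. intros Hcond.
    destruct (Z.ltb_spec k (N + 1)) as [Hk'|]; [easy|].
    split; [exact Hout|]. split; [exact Hfr|].
    replace k with (N + 1) in Hpart by lia.
    eapply partial_table_full; [lia|exact Hv'|exact Hpart].
  - split; [easy|]. split; [frame_solve|].
    exists 0. regs. do 3 (split; [lia|]).
    split; [lia|split; [lia|split; [|lia]]].
    intros c Hc Hle. specialize (Hv c). lia.
Qed.

(** * Tournament trees in memory *)

Definition nodes (m : Z -> Z) (base j : Z) : Z := m (base + N + 1 + j).

Lemma min_nodes_ext t t' skip :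
  (forall j, 1 <= j < 2 * N -> t' j = t j) -> min_nodes N t skip -> min_nodes N t' skip.
Proof. intros E Ht j Hj Hn. rewrite !E by lia. now apply Ht. Qed.

Lemma leaves_ext a b b' t t' p :
  (forall u, 0 <= u <= N -> b' u = b u) ->
  (forall i, 0 <= i < N -> t' (N + i) = t (N + i)) ->
  leaves N a b t p -> leaves N a b' t' p.
Proof.
  intros Eb Et Hl i Hi. destruct (Hl i Hi) as [Hp E]. split; [exact Hp|].
  rewrite Et by exact Hi. now rewrite Eb by lia.
Qed.

Lemma nodes_updm m base j v k :
  nodes (updm m (base + N + 1 + j) v) base k = updm (nodes m base) j v k.
Proof.
  unfold nodes, updm.
  destruct (Z.eqb_spec (base + N + 1 + j) (base + N + 1 + k)), (Z.eqb_spec j k);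
    lia || reflexivity.
Qed.

Lemma min_spec f m base j :
  f rN = N -> f rbase = base -> f rjj = j -> 1 <= j < N ->
  n <= base -> base + 3 * N + 1 <= Z.of_nat L ->
  tri lb L min_cmd f m 3 (fun f' m' =>
    frame [ra; rb] f f' /\
    m' = updm m (base + N + 1 + j)
           (Z.min (nodes m base (2 * j)) (nodes m base (2 * j + 1)))).
Proof.
  intros GN Eb Ej Hj Hb Hb'. apply tri_bounded. intros _ Hbm. unfold min_cmd.
  apply tri_fetch_seq; auto; regs; [lia|].
  apply tri_fetch_seq; auto; regs; [lia|].
  pose proof (Hbm (base + N + 1 + 2 * j) ltac:(lia)).
  pose proof (Hbm (base + N + 1 + (2 * j + 1)) ltac:(lia)).
  apply tri_store; auto; regs; rewrite ?b2z_min; try lia.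
  split; [frame_solve|]. reflexivity.
Qed.

(** Keys reach [14 * SS + 1]: up to [4 * SS] from a summand [a] and up to [10 * SS + 1] from a
    padded table entry. *)
Lemma code_bound key i u :
  Z.abs key <= 14 * SS + 1 -> 0 <= i < N -> 0 <= u <= N ->
  Z.abs (code N key i u) <= bnd lb.
Proof.
  intros Hk Hi Hu. pose proof (square_sum_nonneg X). pose proof (pow3_pos qn).
  pose proof (code_low N i u Hi Hu).
  etransitivity; [|exact Hcode]. unfold code.
  assert (Z.abs (key * P) <= (14 * SS + 1) * P).
  { rewrite Z.abs_mul, (Z.abs_eq P) by nia. apply Z.mul_le_mono_nonneg_r; nia. }
  nia.
Qed.

Definition tree_time : Z := 2 * N * (eval_time + 9) + 3.

(** The bound [3 * SS] on [f rt] is that of [guess_base]: two forced integers and the guessed part,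
    each at most [SS] in absolute value. *)
Lemma tree_spec f m i j s0 base a :
  globals i j f -> inputs m -> f rs0 = s0 -> f rbase = base ->
  0 <= s0 -> s0 + 2 * q <= n -> n <= base -> base + 3 * N + 1 <= Z.of_nat L ->
  (forall c, a c = f rt + digit_sum (unforced X i j) s0 qn c) ->
  Z.abs (f rt) <= 3 * SS -> Z.abs (m base) <= big ->
  tri lb L tree_cmd f m tree_time (fun f' m' =>
    same_outside m m' (base + N + 1) (base + 3 * N + 1) /\
    frame [racc; re; rs; rx; rlen; rjj; ra; rb] f f' /\
    min_nodes N (nodes m' base) 0 /\
    leaves N a (fun u => m (base + u)) (nodes m' base) (fun _ => 0)).
Proof.
  intros G Hm Es0 Ebase Hs0 Hs0' Hb Hb' Ea Ht Hm0.
  pose proof (square_sum_nonneg X) as B0. pose proof bnd_facts as (B1 & B2 & B3 & B4 & B5 & B6).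
  pose proof (pow3_pos qn) as BN.
  assert (Ha : forall c, Z.abs (a c) <= 4 * SS).
  { intros c. rewrite Ea. pose proof (digit_sum_le_square_sum i j s0 qn c ltac:(lia) ltac:(lia)).
    lia. }
  pose proof G as (Gn & Gq & GN & GH & GP & Gi & Gj).
  unfold tree_cmd, tree_time.
  apply tri_assign_seq; auto; regs; [lia|].
  apply tri_while with (kb := eval_time + 8) (j := 2 * N - 1)
    (I := fun l f' m' => same_outside m m' (base + N + 1) (base + 3 * N + 1) /\
       frame [racc; re; rs; rx; rlen; rjj; ra; rb] f f' /\
       f' rjj = l /\ 0 <= l <= 2 * N - 1 /\
       (forall k, l < k < N -> 1 <= k ->
          nodes m' base k = Z.min (nodes m' base (2 * k)) (nodes m' base (2 * k + 1))) /\
       (forall k, 0 <= k < N -> l < N + k ->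
          nodes m' base (N + k) = code N (a k + m base) k 0));
    auto; try (unfold eval_time; lia).
  - intros l f' m' _ (Hout & Hfr & El & Hl & Hnode & Hleaf).
    regs. intros Hcond.
    destruct (Z.ltb_spec 0 l) as [Hl'|]; [|easy].
    split; [lia|].
    assert (Ebase' : m' base = m base) by (apply Hout; lia).
    apply tri_seq with (k1 := eval_time + 7)
      (Q1 := fun f1 m1 => frame [racc; re; rs; rx; rlen; ra; rb] f' f1 /\
         exists w, m1 = updm m' (base + N + 1 + l) w /\
           (l < N -> w = Z.min (nodes m' base (2 * l)) (nodes m' base (2 * l + 1))) /\
           (N <= l -> w = code N (a (l - N) + m base) (l - N) 0)).
    + apply tri_if; auto; regs; intros Hif.
      * destruct (Z.ltb_spec l N) as [HlN|]; [|easy].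
        eapply tri_conseq; [apply min_spec with (base := base) (j := l); auto; regs; auto; lia| |].
        { unfold eval_time. lia. }
        intros f1 m1 [Hfr1 ->]. split; [frame_solve|].
        eexists. split; [reflexivity|]. split; [reflexivity|lia].
      * destruct (Z.ltb_spec l N) as [|HlN]; [easy|].
        apply tri_assign_seq; auto; regs; [lia|].
        apply tri_assign_seq; auto; regs; [lia|].
        apply tri_assign_seq; auto; regs; [lia|].
        eapply tri_seq with (k1 := eval_time).
        { apply eval_spec with (i := i) (j := j) (s := s0) (len := qn) (c := l - N);
            auto; try lia.
          - apply (globals_frame i j f); [exact G|frame_solve].
          - eapply inputs_outside; [exact Hm|exact Hout|lia]. }
        intros f1 m1 (-> & Hfr1 & Eacc).
        apply tri_fetch_seq; auto; regs; [lia|].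
        assert (Ecode : (f rt + digit_sum (unforced X i j) s0 qn (l - N) + m' base) * P
                          + (l - N) * (N + 1) = code N (a (l - N) + m base) (l - N) 0).
        { rewrite Ea, Ebase'. unfold code. ring. }
        apply tri_store; auto; regs; rewrite ?Ecode; try lia.
        -- apply code_bound; [|lia|lia]. specialize (Ha (l - N)). lia.
        -- split; [frame_solve|]. eexists. split; [reflexivity|]. split; [lia|reflexivity].
    + intros f1 m1 (Hfr1 & w & -> & Hw1 & Hw2).
      apply tri_assign; auto; regs; try lia.
      split; [|split; [frame_solve|split; [reflexivity|split; [lia|split]]]].
      * intros x Hx. unfold updm. destruct (Z.eqb_spec (base + N + 1 + l) x); [lia|].
        now apply Hout.
      * intros k Hk Hk1. rewrite !nodes_updm. unfold updm.
        destruct (Z.eqb_spec l (2 * k)); [lia|]. destruct (Z.eqb_spec l (2 * k + 1)); [lia|].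
        destruct (Z.eqb_spec l k) as [->|]; [apply Hw1; lia|apply Hnode; lia].
      * intros k Hk Hk1. rewrite nodes_updm. unfold updm.
        destruct (Z.eqb_spec l (N + k)) as [E|]; [|apply Hleaf; lia].
        rewrite Hw2 by lia. now replace (l - N) with k by lia.
  - intros l f' m' _ (Hout & Hfr & El & Hl & Hnode & Hleaf).
    regs. intros Hcond.
    destruct (Z.ltb_spec 0 l) as [Hl'|]; [easy|].
    split; [exact Hout|]. split; [exact Hfr|]. split.
    + intros k Hk _. apply Hnode; lia.
    + intros k Hk. split; [lia|]. rewrite Hleaf by lia. now rewrite Z.add_0_r.
  - split; [easy|]. split; [frame_solve|]. regs. split; [reflexivity|].
    split; [lia|]. split; intros; lia.
Qed.

(** * Streams of sums and removal of the least sum *)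

Definition stream (m : Z -> Z) (base : Z) (a v b p : Z -> Z) : Prop :=
  (forall u, 0 <= u <= N -> m (base + u) = b u) /\ table N big v b /\
  min_nodes N (nodes m base) 0 /\ leaves N a b (nodes m base) p.

Lemma stream_ext m m' base a v b p :
  (forall x, base <= x < base + 3 * N + 1 -> m' x = m x) ->
  stream m base a v b p -> stream m' base a v b p.
Proof.
  pose proof (pow3_pos qn). intros E (S1 & S2 & S3 & S4). split; [|split; [exact S2|split]].
  - intros u Hu. rewrite E by lia. now apply S1.
  - eapply min_nodes_ext; [|exact S3]. intros j Hj. unfold nodes. apply E. lia.
  - eapply leaves_ext; [reflexivity| |exact S4]. intros j Hj. unfold nodes. apply E. lia.
Qed.

Definition pop_time : Z := 10 * q + 11.

Lemma pop_spec f m base a v b p i :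
  f rN = N -> f rP = P -> f rbase = base -> n <= base -> base + 3 * N + 1 <= Z.of_nat L ->
  stream m base a v b p -> 0 <= i < N -> Z.abs (a i) <= 4 * SS ->
  (forall c, Z.abs (v c) <= SS) ->
  nodes m base 1 = code N (a i + b (p i)) i (p i) -> a i + b (p i) <= 5 * SS ->
  tri lb L pop_cmd f m pop_time (fun f' m' =>
    same_outside m m' base (base + 3 * N + 1) /\
    frame [ra; rb; rx; rjj] f f' /\
    p i < N /\ stream m' base a v b (updm p i (p i + 1))).
Proof.
  intros GN GP Eb Hb Hb' (S1 & S2 & S3 & S4) Hi Ha Hv Eroot Hkey.
  pose proof (square_sum_nonneg X) as B0. pose proof bnd_facts as (B1 & B2 & B3 & B4 & B5 & B6).
  pose proof (pow3_pos qn) as BN.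
  destruct (S4 i Hi) as [Hp Eleaf].
  assert (Hbig : forall u, 0 <= u <= N -> Z.abs (b u) <= big).
  { intros u Hu. destruct S2 as [T1 _]. destruct (T1 u Hu) as [|(c & _ & E)]; [lia|].
    specialize (Hv c). lia. }
  (* The entry [b N] is [big], too large for a sum of at most [5 * SS]; so the pointer can advance
     inside the table. *)
  assert (HpN : p i < N).
  { destruct (Z.eq_dec (p i) N) as [E|]; [|lia].
    destruct S2 as (_ & _ & _ & EN). rewrite E, EN in Hkey. lia. }
  pose proof (S1 (p i) ltac:(lia)) as Eb1. pose proof (S1 (p i + 1) ltac:(lia)) as Eb2.
  pose proof (Hbig (p i) ltac:(lia)) as Hb1. pose proof (Hbig (p i + 1) ltac:(lia)) as Hb2.
  pose proof (code_leaf N (a i + b (p i)) i (p i) Hi Hp) as D1.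
  pose proof (code_pos N (a i + b (p i)) i (p i) Hi Hp) as D2.
  rewrite <- Eroot in D1, D2.
  assert (Eadr : m (base + N + 2) = nodes m base 1) by (unfold nodes; f_equal; lia).
  assert (Enew : nodes m base 1 + (b (p i + 1) - b (p i)) * P + 1
                 = code N (a i + b (p i + 1)) i (p i + 1)).
  { rewrite Eroot. unfold code. ring. }
  unfold pop_cmd, pop_time.
  apply tri_fetch_seq; auto; regs; [lia|]. rewrite Eadr.
  apply tri_fetch_seq; auto; regs; rewrite ?D2; [lia|]. rewrite Eb1.
  apply tri_fetch_seq; auto; regs; rewrite ?D2; [lia|]. rewrite Eb2.
  apply tri_assign_seq; auto; regs; rewrite ?D1; [lia|].
  apply tri_store_seq; auto; regs; rewrite ?Enew; [lia|apply code_bound; lia|].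
  set (m1 := updm m (base + N + 1 + (N + i)) (code N (a i + b (p i + 1)) i (p i + 1))).
  (* The climb starts at node [N + i < 2 * N <= 2 ^ (2 * q + 1)], by [3 ^ q <= 4 ^ q], and each
     round halves the node number. *)
  apply tri_while with (kb := 4) (j := 2 * q + 1)
    (I := fun l f' m' => same_outside m m' (base + N + 1) (base + 3 * N + 1) /\
       frame [ra; rb; rx; rjj] f f' /\
       (exists jj, f' rjj = jj /\ 1 <= jj < 2 * N /\ jj < 2 ^ l /\
          min_nodes N (nodes m' base) (jj / 2)) /\
       leaves N a b (nodes m' base) (updm p i (p i + 1)));
    auto; try lia.
  - intros l f' m' Hl (Hout & Hfr & (jj & Ejj & Hjj & Hjl & Hnode) & Hleaf).
    regs. intros Hcond.
    destruct (Z.ltb_spec 1 jj) as [Hj1|]; [|easy].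
    assert (Hl1 : 0 < l).
    { destruct (Z.eq_dec l 0) as [->|]; [|lia]. cbn in Hjl. lia. }
    split; [exact Hl1|].
    pose proof (Z.div_mod jj 2 ltac:(lia)). pose proof (Z.mod_pos_bound jj 2 ltac:(lia)).
    apply tri_assign_seq; auto; regs; [lia|].
    eapply tri_conseq; [apply min_spec with (base := base) (j := jj / 2); auto; regs; auto; lia
                       |lia|].
    intros f2 m2 [Hfr2 ->].
    split; [|split; [frame_solve|split]].
    + intros x Hx. unfold updm at 1.
      destruct (Z.eqb_spec (base + N + 1 + jj / 2) x); [lia|]. now apply Hout.
    + exists (jj / 2). regs. split; [reflexivity|]. split; [lia|]. split.
      * replace l with (Z.succ (l - 1)) in Hjl by lia.
        rewrite Z.pow_succ_r in Hjl by lia. lia.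
      * eapply min_nodes_ext; [intros; apply nodes_updm|].
        apply min_nodes_step; [lia|exact Hnode].
    + eapply leaves_ext; [reflexivity| |exact Hleaf].
      intros k Hk. rewrite nodes_updm. unfold updm.
      destruct (Z.eqb_spec (jj / 2) (N + k)); [lia|reflexivity].
  - intros l f' m' Hl (Hout & Hfr & (jj & Ejj & Hjj & Hjl & Hnode) & Hleaf).
    regs. intros Hcond.
    destruct (Z.ltb_spec 1 jj) as [Hj1|]; [easy|].
    split; [intros x Hx; apply Hout; lia|]. split; [exact Hfr|].
    split; [exact HpN|]. split; [|split; [exact S2|split; [|exact Hleaf]]].
    + intros u Hu. rewrite Hout by lia. now apply S1.
    + replace jj with 1 in Hnode by lia. exact Hnode.
  - split; [|split; [frame_solve|split]].
    + intros x Hx. unfold m1, updm.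
      destruct (Z.eqb_spec (base + N + 1 + (N + i)) x); [lia|reflexivity].
    + exists (N + i). regs. split; [reflexivity|]. split; [lia|]. split.
      * pose proof (pow3_le_pow2 qn). rewrite Z.pow_add_r by lia. lia.
      * intros k Hk Hn. unfold m1. rewrite !nodes_updm. unfold updm.
        destruct (Z.eqb_spec (N + i) k); [lia|].
        pose proof (Z.div_mod (N + i) 2 ltac:(lia)).
        pose proof (Z.mod_pos_bound (N + i) 2 ltac:(lia)).
        destruct (Z.eqb_spec (N + i) (2 * k)); [lia|].
        destruct (Z.eqb_spec (N + i) (2 * k + 1)); [lia|]. apply S3; lia.
    + intros k Hk. unfold m1. rewrite nodes_updm. unfold updm.
      destruct (Z.eqb_spec i k) as [->|].
      * rewrite Z.eqb_refl. split; [lia|reflexivity].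
      * destruct (Z.eqb_spec (N + i) (N + k)); [lia|]. now apply S4.
Qed.

Local Notation base1 := n.
Local Notation base2 := (n + 3 * N + 1).

Lemma keys_spec f m :
  f rn = n -> f rN = N -> f rP = P ->
  tri lb L keys_cmd f m 4 (fun f' m' =>
    m' = m /\ frame [ra; ru; rv] f f' /\
    f' ru = nodes m base1 1 / P /\ f' rv = nodes m base2 1 / P).
Proof.
  intros Gn GN GP. pose proof (pow3_pos qn). pose proof cell_count_eq.
  apply tri_bounded. intros _ Hbm.
  assert (E1 : m (n + N + 2) = nodes m base1 1) by (unfold nodes; f_equal; lia).
  assert (E2 : m (n + 4 * N + 3) = nodes m base2 1) by (unfold nodes; f_equal; lia).
  pose proof (Hbm (n + N + 2) ltac:(lia)) as H1.
  pose proof (Hbm (n + 4 * N + 3) ltac:(lia)) as H2.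
  pose proof (abs_div_le (nodes m base1 1) P ltac:(nia)).
  pose proof (abs_div_le (nodes m base2 1) P ltac:(nia)).
  unfold keys_cmd.
  apply tri_fetch_seq; auto; regs; [lia|].
  apply tri_assign_seq; auto; regs; rewrite ?E1; [lia|].
  apply tri_fetch_seq; auto; regs; [lia|].
  apply tri_assign; auto; regs; rewrite ?E1, ?E2; try lia.
  split; [reflexivity|]. split; [frame_solve|]. regs. auto.
Qed.

Lemma stream_pos_lt m base a v b p i :
  stream m base a v b p -> 0 <= i < N -> Z.abs (a i) <= 4 * SS ->
  a i + b (p i) <= 5 * SS -> p i < N.
Proof.
  intros (_ & (_ & _ & _ & EN) & _ & S4) Hi Ha Hkey. pose proof (square_sum_nonneg X).
  destruct (S4 i Hi) as [Hp _].
  destruct (Z.eq_dec (p i) N) as [E|]; [|lia]. rewrite E, EN in Hkey. lia.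
Qed.

(** As long as some pointer is below [N] there is room for one more step, which keeps the loop
    counter of the merge positive. *)
Lemma total_lt p i :
  (forall k, 0 <= k < N -> p k <= N) -> 0 <= i < N -> p i < N ->
  total p (Z.to_nat N) + 1 <= N * N.
Proof.
  intros Hp Hi Hlt.
  pose proof (total_updm p i (p i + 1) (Z.to_nat N) ltac:(lia)) as E.
  destruct (Z.ltb_spec i (Z.of_nat (Z.to_nat N))); [|lia].
  pose proof (total_le (updm p i (p i + 1)) N (Z.to_nat N)) as Hle.
  rewrite (Z2Nat.id N) in Hle by lia.
  enough (total (updm p i (p i + 1)) (Z.to_nat N) <= N * N) by lia.
  apply Hle. intros k Hk. unfold updm. destruct (Z.eqb_spec i k); [lia|]. apply Hp; lia.
Qed.

(** When even the least current sum exceeds [5 * SS], monotonicity of [b] puts every sum of at most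
    [5 * SS] before its pointer, where [separated] applies. *)
Lemma consumed m base a v b p a' b' :
  stream m base a v b p -> separated N a b p a' b' ->
  nodes m base 1 / P > 5 * SS ->
  forall c u k l, 0 <= c < N -> 0 <= u <= N -> 0 <= k < N -> 0 <= l <= N ->
    a c + b u <= 5 * SS -> a c + b u <> a' k + b' l.
Proof.
  intros (_ & (_ & T2 & _) & S3 & S4) Hsep Hroot c u k l Hc Hu Hk Hl Hle.
  pose proof (pow3_pos qn).
  destruct (tree_root N a b (nodes m base) p ltac:(lia) S3 S4) as (i & Hi & Hp & E & Hmin).
  rewrite E, code_key in Hroot by lia.
  destruct (S4 c Hc) as [Hpc _]. apply Hsep; auto.
  destruct (Z_lt_le_dec u (p c)) as [|Hge]; [lia|exfalso].
  specialize (T2 (p c) u ltac:(lia) ltac:(lia)). specialize (Hmin c Hc). lia.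
Qed.

Definition merge_time : Z := 2 * N * N * (pop_time + 7) + 5.

Lemma merge_spec f m i j a1 v1 b1 a2 v2 b2 :
  globals i j f ->
  stream m base1 a1 v1 b1 (fun _ => 0) -> stream m base2 a2 v2 b2 (fun _ => 0) ->
  (forall c, Z.abs (a1 c) <= 4 * SS) -> (forall c, Z.abs (v1 c) <= SS) ->
  (forall c, Z.abs (a2 c) <= 4 * SS) -> (forall c, Z.abs (v2 c) <= SS) ->
  tri lb L merge_cmd f m merge_time (fun f' m' =>
    same_outside m m' n (n + 6 * N + 2) /\
    frame [rbase; ra; rb; rx; rjj; ru; rv] f f' /\
    (f' ru = f' rv /\ f' ru < 5 * SS + 1 <->
     exists c1 c2 c3 c4, 0 <= c1 < N /\ 0 <= c2 < N /\ 0 <= c3 < N /\ 0 <= c4 < N /\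
       a1 c1 + v1 c2 = a2 c3 + v2 c4)).
Proof.
  intros (Gn & Gq & GN & GH & GP & Gi & Gj) St1 St2 Ha1 Hv1 Ha2 Hv2.
  pose proof (square_sum_nonneg X) as B0. pose proof bnd_facts as (B1 & B2 & B3 & B4 & B5 & B6).
  pose proof (pow3_pos qn) as BN. pose proof cell_count_eq as EL.
  assert (BNN : 0 <= N * N) by nia.
  unfold merge_cmd, merge_time.
  eapply tri_seq with (k1 := 4); [apply keys_spec; auto|].
  intros f0 m0 (-> & Hfr0 & Eu0 & Ev0).
  (* The counter is what remains of the [N * N] possible steps in each of the two streams. *)
  apply tri_while with (kb := pop_time + 6) (j := 2 * N * N)
    (I := fun l f' m' => same_outside m m' n (n + 6 * N + 2) /\
       frame [rbase; ra; rb; rx; rjj; ru; rv] f f' /\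
       f' ru = nodes m' base1 1 / P /\ f' rv = nodes m' base2 1 / P /\
       exists p1 p2, stream m' base1 a1 v1 b1 p1 /\ stream m' base2 a2 v2 b2 p2 /\
         separated N a1 b1 p1 a2 b2 /\ separated N a2 b2 p2 a1 b1 /\
         l = 2 * N * N - total p1 (Z.to_nat N) - total p2 (Z.to_nat N));
    auto; try (unfold pop_time; lia).
  - intros l f' m' _ (Hout & Hfr & Eu & Ev & p1 & p2 & S1 & S2 & Sep1 & Sep2 & ->).
    regs. intros Hcond.
    destruct (tree_root N a1 b1 (nodes m' base1) p1) as (i1 & Hi1 & Hp1 & E1 & Hmin1);
      [lia|apply S1|apply S1|].
    destruct (tree_root N a2 b2 (nodes m' base2) p2) as (i2 & Hi2 & Hp2 & E2 & Hmin2);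
      [lia|apply S2|apply S2|].
    pose proof Eu as Eu'. pose proof Ev as Ev'.
    rewrite E1, code_key in Eu' by lia. rewrite E2, code_key in Ev' by lia.
    rewrite <- Eu, <- Ev in Hcond. rewrite Eu', Ev' in Hcond.
    set (u := a1 i1 + b1 (p1 i1)) in *. set (v := a2 i2 + b2 (p2 i2)) in *.
    destruct (Z.ltb_spec u (5 * SS + 1)) as [Hu|]; [|easy].
    destruct (Z.ltb_spec v (5 * SS + 1)) as [Hv|]; [|easy].
    destruct (Z.eqb_spec u v) as [|Huv]; [easy|]. clear Hcond.
    assert (Hlt1 : p1 i1 < N) by (eapply stream_pos_lt; eauto; fold u; lia).
    assert (Hlt2 : p2 i2 < N) by (eapply stream_pos_lt; eauto; fold v; lia).
    assert (Hle1 : forall k, 0 <= k < N -> 0 <= p1 k <= N) by (intros k Hk; now apply S1).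
    assert (Hle2 : forall k, 0 <= k < N -> 0 <= p2 k <= N) by (intros k Hk; now apply S2).
    pose proof (total_lt p1 i1 ltac:(intros k Hk; now apply Hle1) Hi1 Hlt1).
    pose proof (total_lt p2 i2 ltac:(intros k Hk; now apply Hle2) Hi2 Hlt2).
    split; [lia|].
    pose proof (total_updm p1 i1 (p1 i1 + 1) (Z.to_nat N) ltac:(lia)) as Et1.
    pose proof (total_updm p2 i2 (p2 i2 + 1) (Z.to_nat N) ltac:(lia)) as Et2.
    destruct (Z.ltb_spec i1 (Z.of_nat (Z.to_nat N))); [|lia].
    destruct (Z.ltb_spec i2 (Z.of_nat (Z.to_nat N))); [|lia].
    assert (Hsel : forall x, (x = base1 \/ x = base2) -> Z.abs x <= bnd lb) by lia.
    apply tri_seq with (k1 := 2)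
      (Q1 := fun f1 m1 => m1 = m' /\ frame [rbase] f' f1 /\
               (u < v /\ f1 rbase = base1 \/ v < u /\ f1 rbase = base2)).
    { apply tri_if; auto; regs; intros Hif;
        destruct (Z.ltb_spec u v); try easy.
      - apply tri_assign; auto; regs; [lia|now apply Hsel; left|].
        split; [reflexivity|]. split; [frame_solve|]. regs. auto.
      - apply tri_assign; auto; regs; [lia|now apply Hsel; right|].
        split; [reflexivity|]. split; [frame_solve|]. regs. right. lia. }
    intros f1 m1 (-> & Hfr1 & [[Hlt Eb]|[Hlt Eb]]).
    + eapply tri_seq with (k1 := pop_time).
      { apply pop_spec with (base := base1) (a := a1) (v := v1) (b := b1) (p := p1) (i := i1);
          auto; regs; auto; lia. }
      intros f2 m2 (Hout2 & Hfr2 & _ & S1').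
      eapply tri_conseq; [apply keys_spec; now regs|lia|].
      intros f3 m3 (-> & Hfr3 & Eu3 & Ev3).
      split; [intros x Hx; rewrite Hout2 by lia; now apply Hout|].
      split; [frame_solve|]. split; [exact Eu3|]. split; [exact Ev3|].
      exists (updm p1 i1 (p1 i1 + 1)), p2. split; [exact S1'|]. split; [|split; [|split; [|lia]]].
      * eapply stream_ext; [|exact S2]. intros x Hx. apply Hout2. lia.
      * apply separated_advance with (p' := p2); auto; try lia; [apply S2| |].
        -- intros k Hk. now apply Hle2.
        -- intros k Hk. specialize (Hmin2 k Hk). fold u. fold v in Hmin2. lia.
      * exact Sep2.
    + eapply tri_seq with (k1 := pop_time).
      { apply pop_spec with (base := base2) (a := a2) (v := v2) (b := b2) (p := p2) (i := i2);
          auto; regs; auto; lia. }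
      intros f2 m2 (Hout2 & Hfr2 & _ & S2').
      eapply tri_conseq; [apply keys_spec; now regs|lia|].
      intros f3 m3 (-> & Hfr3 & Eu3 & Ev3).
      split; [intros x Hx; rewrite Hout2 by lia; apply Hout; lia|].
      split; [frame_solve|]. split; [exact Eu3|]. split; [exact Ev3|].
      exists p1, (updm p2 i2 (p2 i2 + 1)). split; [|split; [exact S2'|split; [|split; [|lia]]]].
      * eapply stream_ext; [|exact S1]. intros x Hx. apply Hout2. lia.
      * exact Sep1.
      * apply separated_advance with (p' := p1); auto; try lia; [apply S1| |].
        -- intros k Hk. now apply Hle1.
        -- intros k Hk. specialize (Hmin1 k Hk). fold v. fold u in Hmin1. lia.
  - intros l f' m' _ (Hout & Hfr & Eu & Ev & p1 & p2 & S1 & S2 & Sep1 & Sep2 & ->).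
    regs. intros Hcond. split; [exact Hout|]. split; [exact Hfr|].
    split.
    + intros [Euv Hu].
      destruct (tree_root N a1 b1 (nodes m' base1) p1) as (i1 & Hi1 & Hp1 & E1 & Hmin1);
        [lia|apply S1|apply S1|].
      destruct (tree_root N a2 b2 (nodes m' base2) p2) as (i2 & Hi2 & Hp2 & E2 & Hmin2);
        [lia|apply S2|apply S2|].
      rewrite E1, E2, !code_key in Euv by lia. rewrite E1, code_key in Hu by lia.
      destruct S1 as (_ & (T1 & _) & _). destruct S2 as (_ & (T2 & _) & _).
      specialize (Ha1 i1). specialize (Ha2 i2).
      (* A padded entry would push the sum above [5 * SS], so both entries are genuine values. *)
      destruct (T1 (p1 i1) Hp1) as [|(c2 & Hc2 & F1)]; [lia|].
      destruct (T2 (p2 i2) Hp2) as [|(c4 & Hc4 & F2)]; [lia|].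
      exists i1, c2, i2, c4. repeat (split; [assumption|]). lia.
    (* If a stream had passed [5 * SS], its part of the match would have been dropped, against
       [separated]. So both keys are in range, and the guard can have failed only because they are
       equal. *)
    + intros (c1 & c2 & c3 & c4 & Hc1 & Hc2 & Hc3 & Hc4 & E).
      destruct (proj1 (proj2 (proj2 (proj1 (proj2 S1)))) c2 Hc2) as (x & Hx & F1).
      destruct (proj1 (proj2 (proj2 (proj1 (proj2 S2)))) c4 Hc4) as (y & Hy & F2).
      specialize (Ha1 c1). specialize (Hv1 c2). specialize (Ha2 c3). specialize (Hv2 c4).
      set (u := nodes m' base1 1 / P) in *. set (v := nodes m' base2 1 / P) in *.
      destruct (Z_le_gt_dec u (5 * SS)) as [Hu|Hu].
      2:{ exfalso. apply (consumed _ _ _ _ _ _ _ _ S1 Sep1 Hu c1 x c3 y); auto; lia. }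
      destruct (Z_le_gt_dec v (5 * SS)) as [Hv|Hv].
      2:{ exfalso. apply (consumed _ _ _ _ _ _ _ _ S2 Sep2 Hv c3 y c1 x); auto; lia. }
      destruct (Z.ltb_spec u (5 * SS + 1)); [|lia].
      destruct (Z.ltb_spec v (5 * SS + 1)); [|lia].
      destruct (Z.eqb_spec u v) as [Euv|]; [lia|]. easy.
  - split; [easy|]. split; [frame_solve|]. split; [exact Eu0|]. split; [exact Ev0|].
    exists (fun _ => 0), (fun _ => 0). split; [exact St1|]. split; [exact St2|].
    split; [|split].
    + intros x u k l Hx Hu. lia.
    + intros x u k l Hx Hu. lia.
    + assert (E0 : forall k, total (fun _ => 0) k = 0)
        by (induction k as [|k IH]; cbn [total]; lia).
      rewrite E0. lia.
Qed.

(** * A single guess *)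

Definition build_time : Z := table_time + tree_time.

Lemma build_spec f m i j s0 base a v :
  globals i j f -> inputs m -> f rs0 = s0 -> f rbase = base ->
  0 <= s0 -> s0 + 2 * q <= n -> n <= base -> base + 3 * N + 1 <= Z.of_nat L ->
  (forall c, a c = f rt + digit_sum (unforced X i j) s0 qn c) ->
  (forall c, v c = digit_sum (unforced X i j) (s0 + q) qn c) ->
  Z.abs (f rt) <= 3 * SS ->
  tri lb L build_cmd f m build_time (fun f' m' =>
    same_outside m m' base (base + 3 * N + 1) /\
    frame [racc; re; rs; rx; rlen; rlast; rk; rcur; rc; rjj; ra; rb] f f' /\
    exists b, stream m' base a v b (fun _ => 0)).
Proof.
  intros G Hm Es0 Ebase Hs0 Hs0' Hb Hb' Ea Ev Ht.
  pose proof (square_sum_nonneg X) as B0. pose proof (pow3_pos qn) as BN.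
  unfold build_cmd, build_time.
  eapply tri_seq with (k1 := table_time).
  { apply table_spec with (i := i) (j := j) (s0 := s0) (base := base) (v := v); auto. }
  intros f1 m1 (Hout1 & Hfr1 & Htab).
  eapply tri_conseq with (k := tree_time); [|lia|].
  - apply tree_spec with (i := i) (j := j) (s0 := s0) (base := base) (a := a);
      auto; regs; auto.
    + apply (globals_frame i j f); [exact G|frame_solve].
    + eapply inputs_outside; eauto.
    + destruct Htab as [T1 _]. specialize (T1 0 ltac:(lia)). rewrite Z.add_0_r in T1.
      destruct T1 as [->|(c & _ & ->)]; [lia|].
      rewrite Ev. pose proof (digit_sum_le_square_sum i j (s0 + q) qn c ltac:(lia) ltac:(lia)). lia.
  - intros f2 m2 (Hout2 & Hfr2 & Hn & Hl).
    split; [intros x Hx; rewrite Hout2 by lia; apply Hout1; lia|].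
    split; [frame_solve|].
    exists (fun u => m1 (base + u)). split; [|split; [exact Htab|split; assumption]].
    intros u Hu. apply Hout2. lia.
Qed.

Definition guess_time : Z := eval_time + 2 * build_time + merge_time + 20.

Lemma at_pos_le_square_sum p : 0 <= p < n -> Z.abs (at_pos X p) <= SS.
Proof.
  intros Hp. pose proof (abs_le_square (at_pos X p)).
  pose proof (wsum_sub_le (fun p => at_pos X p * at_pos X p) 0 (length X) p 1
                ltac:(intros; nia) ltac:(lia) ltac:(lia)) as Hw.
  cbn [wsum] in Hw. unfold square_sum. lia.
Qed.

(** Of the memory only the input has to survive a guess, because tables and trees are rebuilt for
    the next one. *)
Lemma guess_spec f m i j G :
  globals i j f -> inputs m -> f rG = G -> 0 <= G ->
  0 <= i < n -> 0 <= j < n ->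
  tri lb L guess_cmd f m guess_time (fun f' m' =>
    inputs m' /\
    frame [rt; rbase; rs0; rans; racc; re; rs; rx; rk; rlast; rcur; rc; ru; rv;
           rjj; ra; rb; rlen] f f' /\
    (guess_works X qn i j (G / (n * n)) /\ f' rans = 1 \/
     ~ guess_works X qn i j (G / (n * n)) /\ f' rans = f rans)).
Proof.
  intros Gl Hm EG HG Hi Hj.
  pose proof (square_sum_nonneg X) as B0. pose proof bnd_facts as (B1 & B2 & B3 & B4 & B5 & B6).
  pose proof (pow3_pos qn) as BN. pose proof cell_count_eq as EL.
  apply tri_bounded. intros Hbf _.
  specialize (Hbf rG ltac:(unfold nregs; lia)). rewrite EG in Hbf.
  pose proof (abs_div_le G (n * n) ltac:(nia)) as HGn.
  assert (HG0 : 0 <= G / (n * n)) by (apply Z.div_pos; nia).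
  pose proof (at_pos_le_square_sum i Hi) as Hxi. pose proof (at_pos_le_square_sum j Hj) as Hxj.
  set (y := unforced X i j).
  set (g := G / (n * n)) in *.
  pose proof (digit_sum_le_square_sum i j (4 * q) (length X - 4 * qn) g
                ltac:(lia) ltac:(lia)) as Hdg.
  fold y in Hdg.
  pose proof Gl as (Gn & Gq & GN & GH & GP & Gi & Gj).
  unfold guess_cmd, guess_time.
  apply tri_assign_seq; auto; regs; [fold g; lia|].
  apply tri_assign_seq; auto; regs; [lia|].
  apply tri_assign_seq; auto; regs; [lia|].
  eapply tri_seq with (k1 := eval_time).
  { apply eval_spec with (i := i) (j := j) (s := 4 * q) (len := (length X - 4 * qn)%nat) (c := g);
      auto; regs; try lia. }
  intros f1 m1 (-> & Hfr1 & Eacc).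
  apply tri_fetch_seq; auto; regs; [lia|].
  apply tri_fetch_seq; auto; regs; [lia|].
  rewrite !Hm by lia. fold y in Eacc |- *.
  apply tri_assign_seq; auto; regs; [lia|].
  replace (at_pos X i - at_pos X j + digit_sum y (4 * q) (length X - 4 * qn) g)
    with (guess_base X qn i j g) by reflexivity.
  assert (Hgb : Z.abs (guess_base X qn i j g) <= 3 * SS) by (unfold guess_base; fold y; lia).
  apply tri_assign_seq; auto; regs; [lia|].
  apply tri_assign_seq; auto; regs; [lia|].
  set (a1 := fun c => guess_base X qn i j g + digit_sum y 0 qn c).
  set (v1 := fun c => digit_sum y q qn c).
  (* The summand [0] is the value of [rt] for the second stream, in the form that [build_spec]
     expects. *)
  set (a2 := fun c => 0 + digit_sum y (2 * q) qn c).
  set (v2 := fun c => digit_sum y (2 * q + q) qn c).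
  eapply tri_seq with (k1 := build_time).
  { apply build_spec with (i := i) (j := j) (s0 := 0) (base := base1) (a := a1) (v := v1);
      auto; regs; auto; try lia.
    apply (globals_frame i j f); [exact Gl|frame_solve]. }
  intros f2 m2 (Hout2 & Hfr2 & b1 & St1).
  assert (Hm2 : inputs m2) by (eapply inputs_outside; [exact Hm|exact Hout2|lia]).
  apply tri_assign_seq; auto; regs; [lia|].
  apply tri_assign_seq; auto; regs; [lia|].
  apply tri_assign_seq; auto; regs; [lia|].
  eapply tri_seq with (k1 := build_time).
  { apply build_spec with (i := i) (j := j) (s0 := 2 * q) (base := base2) (a := a2) (v := v2);
      auto; regs; auto; try lia.
    apply (globals_frame i j f); [exact Gl|frame_solve]. }
  intros f3 m3 (Hout3 & Hfr3 & b2 & St2).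
  assert (Hm3 : inputs m3) by (eapply inputs_outside; [exact Hm2|exact Hout3|lia]).
  eapply tri_seq with (k1 := merge_time).
  { apply merge_spec with (i := i) (j := j) (a1 := a1) (v1 := v1) (b1 := b1)
      (a2 := a2) (v2 := v2) (b2 := b2).
    - apply (globals_frame i j f); [exact Gl|frame_solve].
    - eapply stream_ext; [|exact St1]. intros x Hx. apply Hout3. lia.
    - exact St2.
    - intros c. unfold a1.
      pose proof (digit_sum_le_square_sum i j 0 qn c ltac:(lia) ltac:(lia)). fold y in H. lia.
    - intros c. apply digit_sum_le_square_sum; lia.
    - intros c. unfold a2.
      pose proof (digit_sum_le_square_sum i j (2 * q) qn c ltac:(lia) ltac:(lia)). fold y in H. lia.
    - intros c. apply digit_sum_le_square_sum; lia. }
  intros f4 m4 (Hout4 & Hfr4 & Hmatch).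
  assert (Hm4 : inputs m4) by (eapply inputs_outside; [exact Hm3|exact Hout4|lia]).
  assert (Hworks : guess_works X qn i j g <-> f4 ru = f4 rv /\ f4 ru < 5 * SS + 1).
  { rewrite Hmatch. unfold guess_works, a1, v1, a2, v2. fold y.
    replace (2 * q + q) with (3 * q) by lia.
    split; intros (c1 & c2 & c3 & c4 & H1 & H2 & H3 & H4 & E);
      exists c1, c2, c3, c4; repeat (split; [assumption|]); lia. }
  apply tri_if; auto; regs; intros Hif.
  - apply tri_assign; auto; regs; try lia.
    split; [exact Hm4|]. split; [frame_solve|]. left. split; [|reflexivity].
    apply Hworks.
    destruct (Z.eqb_spec (f4 ru) (f4 rv)); [|easy].
    destruct (Z.ltb_spec (f4 ru) (5 * SS + 1)); [|easy]. auto.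
  - apply tri_skip; [lia|].
    split; [exact Hm4|]. split; [frame_solve|]. right. split; [|now regs].
    rewrite Hworks. intros [E1 E2].
    destruct (Z.eqb_spec (f4 ru) (f4 rv)); [|easy].
    destruct (Z.ltb_spec (f4 ru) (5 * SS + 1)); [easy|lia].
Qed.

(** * The loop over all guesses *)

Local Notation R := (n * n * 3 ^ Z.of_nat (length X - 4 * qn)).

Definition code_works (G : Z) : Prop :=
  G mod n <> G / n mod n /\ guess_works X qn (G mod n) (G / n mod n) (G / (n * n)).

Definition search_time : Z := R * (guess_time + 6) + 5.

Lemma R_le : 0 <= R /\ R + 1 <= bnd lb.
Proof.
  assert (0 < 3 ^ Z.of_nat (length X - 4 * qn)) by (apply Z.pow_pos_nonneg; lia). nia.
Qed.

Lemma guess_time_nonneg : 0 <= guess_time.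
Proof.
  pose proof (pow3_pos qn).
  unfold guess_time, build_time, table_time, tree_time, merge_time, pop_time, next_time, eval_time.
  assert (0 <= N * (6 * n + 3 + 7)) by nia.
  assert (0 <= (N + 1) * (N * (6 * n + 3 + 7) + 3 + 4)) by nia.
  assert (0 <= 2 * N * (6 * n + 3 + 9)) by nia.
  assert (0 <= N * N) by nia.
  assert (0 <= 2 * N * N * (10 * q + 11 + 7)) by nia.
  lia.
Qed.

Lemma search_spec f m :
  f rn = n -> f rq = q -> f rN = N -> f rH = SS -> f rP = P -> f rR = R -> inputs m ->
  tri lb L search_cmd f m search_time (fun f' m' =>
    f' rn = 1 <-> exists G, 0 <= G < R /\ code_works G).
Proof.
  intros Gn Gq GN GH GP GR Hm.
  pose proof bnd_facts as (B1 & B2 & B3 & B4 & B5 & B6).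
  pose proof R_le as [BR0 BR]. pose proof guess_time_nonneg as BG.
  unfold search_cmd, search_time.
  apply tri_assign_seq; auto; regs; [lia|].
  apply tri_assign_seq; auto; regs; [lia|].
  apply tri_seq with (k1 := R * (guess_time + 6) + 1)
    (Q1 := fun f' m' => Z.abs (f' rans) <= 1 /\
             (f' rans = 1 <-> exists G, 0 <= G < R /\ code_works G)).
  - apply tri_while with (kb := guess_time + 5) (j := R)
      (I := fun l f' m' => inputs m' /\
         frame [rG; ri; rj; rt; rbase; rs0; rans; racc; re; rs; rx; rk; rlast; rcur; rc; ru; rv;
                rjj; ra; rb; rlen] f f' /\
         exists G, f' rG = G /\ 0 <= G <= R /\ l = R - G /\
           (f' rans = 1 /\ (exists G', 0 <= G' < G /\ code_works G') \/
            f' rans = 0 /\ (forall G', 0 <= G' < G -> ~ code_works G')));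
      auto; try lia.
    + intros l f' m' _ (Hm' & Hfr & G & EG & HG & -> & Hans).
      regs. intros Hcond.
      destruct (Z.ltb_spec G R) as [HGR|]; [|easy].
      split; [lia|].
      assert (Hn : 0 < n) by (destruct (Z.eq_dec n 0) as [E0|]; [rewrite E0 in HGR|]; lia).
      pose proof (Z.mod_pos_bound G n Hn) as Hi.
      pose proof (Z.mod_pos_bound (G / n) n Hn) as Hj.
      set (i := G mod n) in *. set (j := G / n mod n) in *.
      apply tri_assign_seq; auto; regs; [fold i; lia|].
      apply tri_assign_seq; auto; regs; [fold j; lia|]. fold i j.
      apply tri_seq with (k1 := guess_time + 2)
        (Q1 := fun f1 m1 => inputs m1 /\
           frame [ri; rj; rt; rbase; rs0; rans; racc; re; rs; rx; rk; rlast; rcur; rc; ru; rv;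
                  rjj; ra; rb; rlen] f' f1 /\
           (code_works G /\ f1 rans = 1 \/ ~ code_works G /\ f1 rans = f' rans)).
      * apply tri_if; auto; regs; intros Hif.
        -- destruct (Z.eqb_spec i j) as [Eij|]; [|easy].
           apply tri_skip; [lia|]. split; [exact Hm'|]. split; [frame_solve|].
           right. split; [|reflexivity]. intros [Hne _]. contradiction.
        -- destruct (Z.eqb_spec i j) as [|Hij]; [easy|].
           eapply tri_conseq.
           ++ apply guess_spec with (i := i) (j := j) (G := G); auto; try lia.
              repeat split; regs; reflexivity.
           ++ lia.
           ++ intros f1 m1 (Hm1 & Hfr1 & Hw). split; [exact Hm1|]. split; [frame_solve|].
              destruct Hw as [[Hw E]|[Hw E]]; [left|right].
              ** split; [split; assumption|exact E].
              ** split; [intros [_ Hw']; now apply Hw|exact E].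
      * intros f1 m1 (Hm1 & Hfr1 & Hw).
        apply tri_assign; auto; regs; try lia.
        split; [exact Hm1|]. split; [frame_solve|].
        exists (G + 1). regs. split; [reflexivity|]. split; [lia|]. split; [lia|].
        destruct Hw as [[Hw E]|[Hw E]].
        -- left. split; [exact E|]. exists G. split; [lia|exact Hw].
        -- rewrite E. destruct Hans as [[Ea (G' & HG' & Hw')]|[Ea Hno]]; [left|right].
           ++ split; [exact Ea|]. exists G'. split; [lia|exact Hw'].
           ++ split; [exact Ea|]. intros G' HG'.
              destruct (Z.eq_dec G' G) as [->|]; [exact Hw|apply Hno; lia].
    + intros l f' m' _ (Hm' & Hfr & G & EG & HG & -> & Hans).
      regs. intros Hcond.
      destruct (Z.ltb_spec G R) as [HGR|]; [easy|].
      replace G with R in Hans by lia.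
      destruct Hans as [[Ea Hex]|[Ea Hno]]; rewrite Ea.
      * split; [lia|]. split; auto.
      * split; [lia|]. split; [lia|]. intros (G' & HG' & Hw). now apply Hno in Hw.
    + split; [exact Hm|]. split; [frame_solve|]. exists 0. regs.
      split; [reflexivity|]. split; [lia|]. split; [lia|]. right.
      split; [reflexivity|]. lia.
  - intros f' m' [Hb Hans].
    apply tri_assign; auto; regs; try lia.
Qed.

(** Mixed radix: [i] and [j] are the two lowest digits in base [n], and the remaining quotient is
    [g]. *)
Lemma code_works_iff :
  (exists G, 0 <= G < R /\ code_works G) <->
  exists i j g, 0 <= i < n /\ 0 <= j < n /\ 0 <= g < 3 ^ Z.of_nat (length X - 4 * qn) /\
    i <> j /\ guess_works X qn i j g.
Proof.
  set (B := 3 ^ Z.of_nat (length X - 4 * qn)).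
  split.
  - intros (G & HG & Hij & Hw).
    assert (Hn : 0 < n) by (destruct (Z.eq_dec n 0) as [E0|]; [rewrite E0 in HG|]; lia).
    exists (G mod n), (G / n mod n), (G / (n * n)).
    split; [now apply Z.mod_pos_bound|]. split; [now apply Z.mod_pos_bound|].
    split; [|split; assumption].
    split; [apply Z.div_pos; nia|apply Z.div_lt_upper_bound; nia].
  - intros (i & j & g & Hi & Hj & Hg & Hij & Hw).
    exists (i + (j + g * n) * n).
    assert (E1 : (i + (j + g * n) * n) mod n = i)
      by (rewrite Z.mod_add, Z.mod_small; lia).
    assert (E2 : (i + (j + g * n) * n) / n = j + g * n)
      by (rewrite Z.div_add, Z.div_small; lia).
    unfold code_works. rewrite <- Z.div_div, E1, E2 by lia.
    rewrite Z.mod_add, Z.mod_small, Z.div_add, Z.div_small by lia. rewrite Z.add_0_l.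
    split; [|split; assumption].
    assert (0 <= g * n) by nia.
    assert (g * n <= (B - 1) * n) by nia.
    split; [nia|].
    assert ((j + g * n) * n <= (n - 1 + (B - 1) * n) * n) by nia. nia.
Qed.

(** * Setup and the whole program *)

Definition setup_time : Z := 10 * n + 20.

(** The memory still has its initial length here, since the address of its last cell depends on the
    value [N] computed by the setup. *)
Lemma setup_spec f m S :
  f rn = n -> f rS = S -> inputs m ->
  N <= S -> S <= bnd lb -> n < 4 * q + 4 \/ S < 3 * N ->
  tri lb (length X) setup_cmd f m setup_time (fun f' m' => m' = m /\
    f' rn = n /\ f' rq = q /\ f' rN = N /\ f' rH = SS /\ f' rP = P /\ f' rR = R).
Proof.
  intros Gn GS Hm HNS HSb Hmax.
  pose proof (square_sum_nonneg X) as B0. pose proof bnd_facts as (B1 & B2 & B3 & B4 & B5 & B6).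
  pose proof (pow3_pos qn) as BN. pose proof R_le as [BR0 BR].
  unfold setup_cmd, setup_time.
  apply tri_assign_seq; auto; regs; [lia|].
  apply tri_assign_seq; auto; regs; [lia|].
  apply tri_seq with (k1 := 3 * q + 1)
    (Q1 := fun f' m' => m' = m /\ frame [rq; rN] f f' /\ f' rq = q /\ f' rN = N).
  { apply tri_while with (kb := 2) (j := q)
      (I := fun l f' m' => m' = m /\ frame [rq; rN] f f' /\
         exists k, l = q - k /\ 0 <= k <= q /\ f' rq = k /\ f' rN = 3 ^ k);
      auto; try lia.
    - intros l f' m' _ (-> & Hfr & k & -> & Hk & E1 & E2).
      regs. intros Hcond.
      assert (Hkq : k < q).
      { destruct (Z.eq_dec k q) as [->|]; [exfalso|lia].
        destruct (Z.ltb_spec (4 * q + 3) n), (Z.ltb_spec (3 * N) (S + 1));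
          cbn in Hcond; lia. }
      split; [lia|].
      assert (H3 : 3 * 3 ^ k <= N).
      { rewrite <- Z.pow_succ_r by lia. apply Z.pow_le_mono_r; lia. }
      assert (0 < 3 ^ k) by (apply Z.pow_pos_nonneg; lia).
      apply tri_assign_seq; auto; regs; [lia|].
      apply tri_assign; auto; regs; try lia.
      split; [reflexivity|]. split; [frame_solve|].
      exists (k + 1). regs. split; [lia|]. split; [lia|]. split; [reflexivity|].
      rewrite Z.pow_add_r by lia. lia.
    - intros l f' m' _ (-> & Hfr & k & -> & Hk & E1 & E2).
      regs. intros Hcond. split; [reflexivity|]. split; [exact Hfr|].
      enough (Ekq : k = q) by (rewrite Ekq; auto).
      destruct (Z.eq_dec k q) as [|Hne]; [assumption|exfalso].
      assert (H3 : 3 * 3 ^ k <= N).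
      { rewrite <- Z.pow_succ_r by lia. apply Z.pow_le_mono_r; lia. }
      destruct (Z.ltb_spec (4 * k + 3) n), (Z.ltb_spec (3 * 3 ^ k) (S + 1)); cbn in Hcond; lia.
    - split; [reflexivity|]. split; [frame_solve|]. exists 0. regs.
      split; [lia|]. split; [lia|]. auto. }
  intros f1 m1 (-> & Hfr1 & Eq1 & EN1).
  apply tri_assign_seq; auto; regs; [nia|].
  apply tri_assign_seq; auto; regs; [lia|].
  apply tri_assign_seq; auto; regs; [lia|].
  set (sq := fun p => at_pos X p * at_pos X p).
  apply tri_seq with (k1 := 4 * n + 1)
    (Q1 := fun f' m' => m' = m /\ frame [rx; rH; rk; rP] f1 f' /\ f' rH = SS /\ f' rP = P).
  { apply tri_while with (kb := 3) (j := n)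
      (I := fun l f' m' => m' = m /\ frame [rx; rH; rk; rP] f1 f' /\ f' rP = P /\
         exists l' k h, l = Z.of_nat l' /\ l = n - k /\ 0 <= k <= n /\ f' rk = k /\ f' rH = h /\
           0 <= h /\ h + wsum sq k l' = SS);
      auto; try lia.
    - intros l f' m' _ (-> & Hfr & EP & l' & k & h & -> & El & Hk & Ek & Eh & Hh & Hsum).
      regs. intros Hcond.
      destruct (Z.ltb_spec k n) as [Hkn|]; [|easy].
      split; [lia|]. destruct l' as [|l']; [lia|]. cbn [wsum] in Hsum.
      assert (Hsq : forall p, 0 <= sq p) by (intros p; unfold sq; nia).
      pose proof (wsum_nonneg sq (k + 1) l' Hsq). pose proof (Hsq k).
      apply tri_fetch_seq; auto; regs; [lia|]. rewrite Hm by lia.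
      apply tri_assign_seq; auto; regs; fold (sq k); [lia|].
      apply tri_assign; auto; regs; try lia.
      split; [reflexivity|]. split; [frame_solve|]. regs. split; [reflexivity|].
      exists l', (k + 1), (h + sq k). regs. repeat (split; [lia|]). lia.
    - intros l f' m' _ (-> & Hfr & EP & l' & k & h & -> & El & Hk & Ek & Eh & Hh & Hsum).
      regs. intros Hcond.
      destruct (Z.ltb_spec k n) as [Hkn|]; [easy|].
      destruct l' as [|l']; [|lia]. cbn [wsum] in Hsum.
      split; [reflexivity|]. split; [exact Hfr|]. split; [lia|reflexivity].
    - split; [reflexivity|]. split; [frame_solve|]. regs. split; [reflexivity|].
      exists (length X), 0, 0. regs. repeat (split; [lia|]). reflexivity. }
  intros f2 m2 (-> & Hfr2 & EH2 & EP2).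
  apply tri_assign_seq; auto; regs; [lia|].
  apply tri_assign_seq; auto; regs; [nia|].
  apply tri_while with (kb := 2) (j := n - 4 * q)
    (I := fun l f' m' => m' = m /\ frame [rR; rk] f2 f' /\
       exists k r, l = n - k /\ 0 <= k <= n /\ f' rk = k /\ f' rR = r /\ 0 <= r /\
         r * 3 ^ l = R);
    auto; try lia.
  - intros l f' m' Hl (-> & Hfr & k & r & -> & Hk & Ek & Er & Hr & HR).
    regs. intros Hcond.
    destruct (Z.ltb_spec k n) as [Hkn|]; [|easy].
    split; [lia|].
    replace (n - k) with (Z.succ (n - k - 1)) in HR by lia.
    rewrite Z.pow_succ_r in HR by lia.
    assert (H3t : 0 < 3 ^ (n - k - 1)) by (apply Z.pow_pos_nonneg; lia).
    assert (H3r : 3 * r <= R) by (rewrite <- HR; clear - Hr H3t; nia).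
    apply tri_assign_seq; auto; regs; [lia|].
    apply tri_assign; auto; regs; try lia.
    split; [reflexivity|]. split; [frame_solve|].
    exists (k + 1), (3 * r). regs. repeat (split; [lia|]). rewrite <- HR. ring.
  - intros l f' m' Hl (-> & Hfr & k & r & -> & Hk & Ek & Er & Hr & HR).
    regs. intros Hcond.
    destruct (Z.ltb_spec k n) as [Hkn|]; [easy|].
    replace (n - k) with 0 in HR by lia. rewrite Z.pow_0_r in HR.
    repeat (split; [now regs|]). lia.
  - split; [reflexivity|]. split; [frame_solve|].
    exists (4 * q), (n * n). regs. split; [lia|]. split; [lia|].
    split; [reflexivity|]. split; [reflexivity|]. split; [nia|].
    do 2 f_equal. lia.
Qed.

Definition init_regs (S : Z) (r : nat) : Z := nth r [n; S] 0.

Definition main_time : Z := setup_time + search_time + 2.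

(** The two extending writes change the shape of the state, so they fall outside [tri] and are
    executed by hand. *)
Lemma main_spec S :
  NoDup X -> N <= Z.of_nat S -> Z.of_nat S <= bnd lb ->
  n < 4 * q + 4 \/ Z.of_nat S < 3 * N ->
  exists s t u, exec main_cmd (init S X) s t u /\
    Z.of_nat t <= main_time * step_time lb /\ (u <= space_bound lb L)%nat /\
    (get (regs s) 0 = 1 <-> equal_subset_sum X).
Proof.
  intros HX HNS HSb Hmax.
  pose proof (square_sum_nonneg X) as B0. pose proof bnd_facts as (B1 & B2 & B3 & B4 & B5 & B6).
  pose proof (pow3_pos qn) as BN. pose proof cell_count_eq as EL.
  set (f0 := init_regs (Z.of_nat S)). set (m0 := at_pos X).
  assert (Hsmall : forall x, Z.abs (at_pos X x) <= bnd lb).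
  { intros x. replace (at_pos X x) with (at_pos X (Z.max x 0)).
    - destruct (Z_lt_le_dec (Z.max x 0) n) as [Hx'|Hx'].
      + pose proof (at_pos_le_square_sum (Z.max x 0) ltac:(lia)). lia.
      + unfold at_pos. rewrite nth_overflow by lia. lia.
    - unfold at_pos. f_equal. lia. }
  assert (Hbf : bounded_regs lb f0).
  { intros [|[|[|r]]] _; unfold f0, init_regs; cbn [nth]; lia. }
  assert (Hbm : forall L, bounded_mem lb L m0) by (intros L a _; apply Hsmall).
  assert (Ecells : cells (length X) m0 = X) by apply map_at_pos.
  assert (Einit : set_reg (init S X) 30 0 = st (length X) f0 m0).
  { unfold st. rewrite Ecells. reflexivity. }
  assert (Hext : forall f, set_mem (st (length X) f m0) (Z.of_nat (L - 1)) 0 = st L f m0).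
  { intros f. unfold set_mem, st. cbn [regs mem]. rewrite Nat2Z.id.
    rewrite cells_extend; [reflexivity|unfold cell_count; lia|].
    intros a Ha. unfold m0, at_pos. apply nth_overflow. lia. }
  destruct (setup_spec f0 m0 (Z.of_nat S)) as
    (f1 & m1 & t1 & u1 & He1 & Ht1 & Hu1 & Hbf1 & _ & -> & Gn & Gq & GN & GH & GP & GR);
    auto; try reflexivity; try (intros p _; reflexivity).
  destruct (search_spec f1 m0) as
    (f2 & m2 & t2 & u2 & He2 & Ht2 & Hu2 & _ & _ & Hans);
    auto; try (intros p _; reflexivity).
  assert (Hmono : (space_bound lb (length X) <= space_bound lb L)%nat)
    by (apply Nat.mul_le_mono_r; unfold cell_count; lia).
  assert (Hsp : forall f, bounded_regs lb f ->
            (space (st (length X) f m0) <= space_bound lb L)%nat).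
  { intros f Hf. etransitivity; [apply (space_st lb); auto|exact Hmono]. }
  assert (Hsp0 : (space (init S X) <= space_bound lb L)%nat).
  { unfold space, init. cbn [regs mem].
    pose proof (list_bits_le lb [n; Z.of_nat S]) as H1.
    pose proof (list_bits_le lb X) as H2.
    assert (list_bits [n; Z.of_nat S] <= 2 * (lb + 2))%nat.
    { apply H1. unfold bnd in *. intros z [<-|[<-|[]]]; lia. }
    assert (list_bits X <= length X * (lb + 2))%nat.
    { apply H2. intros z Hz. apply (In_nth X z 0) in Hz as (k & Hk & <-).
      specialize (Hsmall (Z.of_nat k)). unfold at_pos in Hsmall. now rewrite Nat2Z.id in Hsmall. }
    assert ((2 + length X) * (lb + 2) <= space_bound lb L)%nat
      by (apply Nat.mul_le_mono_r; unfold cell_count, nregs; lia).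
    lia. }
  pose proof (exec_assign (init S X) 30 0) as Hx1. cbv zeta in Hx1.
  change (eval (init S X) 0) with 0 in Hx1. rewrite Einit in Hx1.
  pose proof (exec_store (st (length X) f1 m0) (rn + 6 * rN + 1) 0) as Hx2. cbv zeta in Hx2.
  rewrite (eval_st _ f1 m0 (rn + 6 * rN + 1) eq_refl) in Hx2.
  assert (Ead : evalf f1 (rn + 6 * rN + 1)%expr = Z.of_nat (L - 1)).
  { cbn [evalf eval_op]. rewrite Gn, GN. unfold cell_count. lia. }
  rewrite Ead in Hx2. change (eval (st (length X) f1 m0) 0) with 0 in Hx2.
  rewrite Hext in Hx2.
  exists (st L f2 m2). do 2 eexists. split; [|split; [|split]].
  - unfold main_cmd. eapply exec_seq; [exact Hx1|].
    eapply exec_seq; [exact He1|]. eapply exec_seq; [exact Hx2|exact He2].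
  - pose proof (good_cost lb (length X) f1 m0 (rn + 6 * rN + 1) Hlb Hbf1 eq_refl).
    change (cost (init S X) 0) with 2%nat.
    change (cost (st (length X) f1 m0) 0) with 2%nat.
    unfold main_time. rewrite !Z.mul_add_distr_r.
    assert (2 + Z.of_nat (cost (st (length X) f1 m0) (rn + 6 * rN + 1)) + 2 <= 2 * step_time lb)
      by (unfold step_time; lia).
    lia.
  - repeat apply Nat.max_lub; auto; [lia|]. now apply space_st.
  - change (get (regs (st L f2 m2)) 0) with (f2 rn).
    rewrite Hans, code_works_iff. symmetry. now apply equal_subset_sum_guess.
Qed.

End Search.

End Program.

(** * Time and space bounds *)

(** Increase [q] until one of the two constraints forbids the next step; [d] bounds the number of
    increases left. *)
Lemma block_length_exists n S :
  0 <= n -> 1 <= S ->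
  exists q : nat, 4 * Z.of_nat q <= n /\ 3 ^ Z.of_nat q <= S /\
    (n < 4 * Z.of_nat q + 4 \/ S < 3 * 3 ^ Z.of_nat q).
Proof.
  intros Hn HS.
  enough (G : forall d q, n - 4 * Z.of_nat q < Z.of_nat d ->
            4 * Z.of_nat q <= n -> 3 ^ Z.of_nat q <= S ->
            exists q : nat, 4 * Z.of_nat q <= n /\ 3 ^ Z.of_nat q <= S /\
              (n < 4 * Z.of_nat q + 4 \/ S < 3 * 3 ^ Z.of_nat q)).
  { apply (G (Z.to_nat (n + 1)) 0%nat); cbn; lia. }
  induction d as [|d IH]; intros q Hd Hq HN; [lia|].
  destruct (Z_lt_le_dec n (4 * Z.of_nat q + 4)); [eauto|].
  destruct (Z_lt_le_dec S (3 * 3 ^ Z.of_nat q)); [eauto|].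
  apply (IH (1 + q)%nat); [lia|lia|].
  rewrite Nat2Z.inj_add, Z.pow_add_r by lia. lia.
Qed.

Lemma length_le_input_size X : (length X <= input_size X)%nat.
Proof.
  unfold input_size, list_bits. induction X as [|x X IH]; [cbn; lia|].
  change (S (length X) <= bits x + list_sum (map bits X))%nat.
  assert (2 <= bits x)%nat by (unfold bits; lia). lia.
Qed.

(** Each integer contributes a factor of at least [4 * (x * x + 1)], and the product of such factors
    dominates the sum of the squares. *)
Lemma square_sum_le_pow X : square_sum X + 1 <= 2 ^ (2 * Z.of_nat (input_size X)).
Proof.
  unfold square_sum. change 0 with (Z.of_nat 0). rewrite wsum_Zsum.
  rewrite <- (map_map (fun k => at_pos X (Z.of_nat k)) (fun z => z * z)), map_at_pos.
  unfold input_size, list_bits. induction X as [|x X IH]; [cbn; lia|].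
  change (x * x + Zsum (map (fun z => z * z) X) + 1
          <= 2 ^ (2 * Z.of_nat (bits x + list_sum (map bits X)))).
  rewrite Nat2Z.inj_add, Z.mul_add_distr_l, Z.pow_add_r by lia.
  set (e := 2 ^ (2 * Z.of_nat (list_sum (map bits X)))) in *.
  assert (He : 1 <= e) by (assert (0 < e) by (apply Z.pow_pos_nonneg; lia); lia).
  assert (Hx : 4 * (x * x) + 4 <= 2 ^ (2 * Z.of_nat (bits x))).
  { unfold bits.
    pose proof (Z.log2_nonneg (Z.abs x)).
    rewrite Nat2Z.inj_add, Z2Nat.id by lia.
    set (l := Z.log2 (Z.abs x)) in *.
    assert (Hl : Z.abs x < 2 ^ (l + 1)).
    { destruct (Z.eq_dec x 0) as [->|]; [apply Z.pow_pos_nonneg; lia|].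
      apply Z.log2_spec. lia. }
    replace (2 * (l + Z.of_nat 2)) with ((l + 1) + (l + 1) + 2) by lia.
    rewrite !Z.pow_add_r by lia. rewrite !Z.pow_add_r in Hl by lia.
    change (2 ^ 2) with 4. change (2 ^ 1) with 2 in *.
    assert (0 < 2 ^ l) by (apply Z.pow_pos_nonneg; lia).
    assert (x * x + 1 <= 2 ^ l * 2 * (2 ^ l * 2)) by nia. lia. }
  nia.
Qed.

Lemma succ_le_pow2 k : Z.of_nat k + 1 <= 2 ^ Z.of_nat k.
Proof. pose proof (Z.pow_gt_lin_r 2 (Z.of_nat k)). lia. Qed.

(** With [b] the input size, the exponent splits into [5 + 2 * b] for the first factor, [b] for
    [3 ^ q], by [4 * q <= n], and [b + 1] for its successor. *)
Lemma code_range_le X q :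
  (4 * q <= length X)%nat ->
  (30 * square_sum X + 30) * (3 ^ Z.of_nat q * (3 ^ Z.of_nat q + 1))
    <= 2 ^ (4 * Z.of_nat (input_size X) + 6).
Proof.
  intros Hq. set (b := Z.of_nat (input_size X)).
  pose proof (length_le_input_size X) as Hb.
  assert (HN : 3 ^ Z.of_nat q <= 2 ^ b).
  { etransitivity; [apply pow3_le_pow2|]. apply Z.pow_le_mono_r; unfold b; lia. }
  pose proof (square_sum_le_pow X) as HH. fold b in HH.
  pose proof (square_sum_nonneg X).
  assert (0 < 3 ^ Z.of_nat q) by (apply Z.pow_pos_nonneg; lia).
  replace (4 * b + 6) with (5 + 2 * b + (b + (b + 1))) by lia.
  rewrite Z.pow_add_r, (Z.pow_add_r 2 5), (Z.pow_add_r 2 b), (Z.pow_add_r 2 b 1) by lia.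
  apply Z.mul_le_mono_nonneg; [lia| |nia|].
  - change (2 ^ 5) with 32. lia.
  - apply Z.mul_le_mono_nonneg; lia.
Qed.

Lemma guess_range_le X q :
  (Z.of_nat (length X) + 1) * (Z.of_nat (length X) + 1) * 3 ^ Z.of_nat (length X - 4 * q)
    <= 2 ^ (4 * Z.of_nat (input_size X)).
Proof.
  pose proof (length_le_input_size X) as Hb.
  set (n := Z.of_nat (length X)). set (b := Z.of_nat (input_size X)).
  assert (Hn : n + 1 <= 2 ^ b).
  { etransitivity; [apply succ_le_pow2|]. apply Z.pow_le_mono_r; lia. }
  assert (H3 : 3 ^ Z.of_nat (length X - 4 * q) <= 2 ^ (2 * b)).
  { etransitivity; [apply pow3_le_pow2|]. apply Z.pow_le_mono_r; lia. }
  replace (4 * b) with (b + b + 2 * b) by lia.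
  rewrite Z.pow_add_r, (Z.pow_add_r 2 b b) by lia.
  assert (0 < 3 ^ Z.of_nat (length X - 4 * q)) by (apply Z.pow_pos_nonneg; lia).
  apply Z.mul_le_mono_nonneg; [nia| |lia|exact H3].
  apply Z.mul_le_mono_nonneg; lia.
Qed.

Lemma main_time_le X q :
  (4 * q <= length X)%nat ->
  main_time X q <= 250 * (Z.of_nat (length X) + 1) ^ 3 *
    (3 ^ Z.of_nat (length X - 4 * q) * (3 ^ Z.of_nat q * 3 ^ Z.of_nat q)).
Proof.
  intros Hq. pose proof (pow3_pos q) as HN. pose proof (pow3_pos (length X - 4 * q)) as HB.
  unfold main_time, search_time, guess_time, build_time, table_time, tree_time, merge_time,
    pop_time, next_time, setup_time, eval_time.
  set (N := 3 ^ Z.of_nat q) in *. set (B := 3 ^ Z.of_nat (length X - 4 * q)) in *.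
  assert (Hqn : 0 <= 4 * Z.of_nat q <= Z.of_nat (length X)) by lia.
  remember (Z.of_nat q) as q' eqn:E; clear E.
  remember (Z.of_nat (length X)) as n eqn:E; clear E. clearbody N B. clear Hq.
  (* With [u = n + 1 >= 1] and [N >= 1], every monomial in the time of one guess is absorbed by
     [u * N ^ 2]; two more factors [u] come from the pairs [(i, j)]. The products get names of their
     own so that most of the later goals are linear. *)
  assert (En : n = (n + 1) - 1) by lia. set (u := n + 1) in *. clearbody u. subst n.
  assert (Hu : 1 <= u) by lia.
  remember (N * N) as M eqn:EM. remember (u * N) as uN eqn:EuN.
  remember (u * M) as uM eqn:EuM.
  assert (L1 : N <= M) by (clear - EM HN; nia).
  assert (L2 : N <= uN) by (clear - EuN Hu HN; nia).
  assert (L3 : M <= uM) by (clear - EuM Hu L1 HN; nia).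
  assert (L4 : uN <= uM) by (clear - EuM EuN L1 Hu; nia).
  assert (L5 : u <= uN) by (clear - EuN Hu HN; nia).
  assert (Hb : 0 <= N * (6 * (u - 1) + 3 + 7) + 3 <= 13 * uN) by lia.
  set (b := N * (6 * (u - 1) + 3 + 7) + 3) in *. clearbody b.
  assert (Ht : 0 <= (N + 1) * (b + 4) + 3 <= 37 * uM).
  { assert (E : (N + 1) * (b + 4) <= (2 * N) * (17 * uN))
      by (apply Z.mul_le_mono_nonneg; lia).
    replace (2 * N * (17 * uN)) with (34 * uM) in E by (subst; ring).
    assert (0 <= (N + 1) * (b + 4)) by (clear - HN Hb; nia). lia. }
  set (t := (N + 1) * (b + 4) + 3) in *. clearbody t.
  assert (Hm : 0 <= 2 * N * N * (10 * q' + 11 + 7) + 5 <= 41 * uM).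
  { replace (2 * N * N * (10 * q' + 11 + 7)) with (M * (20 * q' + 36)) by (subst; ring).
    assert (0 <= M * (20 * q' + 36)) by (clear - L1 HN Hqn; nia).
    assert (M * (20 * q' + 36) <= M * (36 * u)) by (apply Z.mul_le_mono_nonneg_l; lia).
    lia. }
  set (m := 2 * N * N * (10 * q' + 11 + 7) + 5) in *. clearbody m.
  set (g := 6 * (u - 1) + 3 + 2 * (t + (2 * N * (6 * (u - 1) + 3 + 9) + 3)) + m + 20).
  assert (Hg : 0 <= g + 6 <= 220 * uM) by (unfold g; lia). clearbody g.
  assert (HuB : u <= u * u * B) by (clear - Hu HB; nia).
  assert (Hs : (u - 1) * (u - 1) * B * (g + 6) <= u * u * B * (220 * uM)).
  { apply Z.mul_le_mono_nonneg; [apply Z.mul_nonneg_nonneg; [clear - Hu; nia|lia]| |lia|lia].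
    apply Z.mul_le_mono_nonneg_r; [lia|clear - Hu; nia]. }
  assert (HuBM : u <= u * u * B * uM) by (clear - HuB Hu L1 L3 HN; nia).
  replace (250 * u ^ 3 * (B * M)) with (250 * (u * u * B * uM)) by (subst; ring).
  lia.
Qed.

(** The premise on [e] is the bound [3 ^ (n / 4)] without fractional exponents. It is used with
    [e = n], to bound the length of the register that holds the budget, and with [e = q + 1], when
    the number of integers is what limits [q]. *)
Lemma within_budget X S c k :
  NoDup X -> (1 <= S)%nat ->
  (forall e, (length X <= 4 * e)%nat ->
     Z.of_nat S <= Z.of_nat c * (Z.of_nat (input_size X) + 1) ^ Z.of_nat k * 3 ^ Z.of_nat e) ->
  exists s t u, exec main_cmd (init S X) s t u /\
    (get (regs s) 0 = 1 <-> equal_subset_sum X) /\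
    Z.of_nat u <= 40 * (Z.of_nat c + Z.of_nat k + 12) * (Z.of_nat (input_size X) + 1) ^ 2
                  * Z.of_nat S /\
    Z.of_nat t * Z.of_nat S ^ 2 <=
      9000000 * (Z.of_nat c + Z.of_nat k + 11) * (Z.of_nat c + 1) ^ 2
      * (Z.of_nat (input_size X) + 1) ^ (2 * Z.of_nat k + 4) * 3 ^ Z.of_nat (length X).
Proof.
  intros HX HS Hbudget.
  pose proof (length_le_input_size X) as Hnb.
  destruct (block_length_exists (Z.of_nat (length X)) (Z.of_nat S)) as (q & Hq & HNS & Hmax);
    [lia|lia|].
  (* With [b] the input size, the budget is at most [2 ^ (c + b * k + 2 * n)], and the codes need
     [4 * b + 6] bits. *)
  set (lb := ((c + k + 10) * (input_size X + 1))%nat).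
  assert (Hlb : 4 * Z.of_nat (input_size X) + 6 <= Z.of_nat lb) by (unfold lb; nia).
  assert (Hq' : (4 * q <= length X)%nat) by lia.
  assert (Hcode : (30 * square_sum X + 30) * (3 ^ Z.of_nat q * (3 ^ Z.of_nat q + 1)) <= bnd lb).
  { etransitivity; [now apply code_range_le|]. apply Z.pow_le_mono_r; lia. }
  assert (Hguess : (Z.of_nat (length X) + 1) * (Z.of_nat (length X) + 1) *
                   3 ^ Z.of_nat (length X - 4 * q) <= bnd lb).
  { etransitivity; [apply guess_range_le|]. apply Z.pow_le_mono_r; lia. }
  assert (HSb : Z.of_nat S <= bnd lb).
  { etransitivity; [apply (Hbudget (length X)); lia|].
    assert (H1 : Z.of_nat c <= 2 ^ Z.of_nat c) by (pose proof (succ_le_pow2 c); lia).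
    assert (H2 : (Z.of_nat (input_size X) + 1) ^ Z.of_nat k
                 <= 2 ^ (Z.of_nat (input_size X) * Z.of_nat k)).
    { rewrite Z.pow_mul_r by lia. apply Z.pow_le_mono_l.
      pose proof (succ_le_pow2 (input_size X)). lia. }
    pose proof (pow3_le_pow2 (length X)) as H3.
    assert (0 <= (Z.of_nat (input_size X) + 1) ^ Z.of_nat k) by (apply Z.pow_nonneg; lia).
    assert (0 <= 3 ^ Z.of_nat (length X)) by (apply Z.pow_nonneg; lia).
    etransitivity;
      [apply Z.mul_le_mono_nonneg; [nia|apply Z.mul_le_mono_nonneg|lia|exact H3]; eauto; lia|].
    rewrite <- !Z.pow_add_r by nia. apply Z.pow_le_mono_r; [lia|]. unfold lb. nia. }
  destruct (main_spec X q lb ltac:(lia) Hq' Hcode Hguess S HX HNS HSb Hmax)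
    as (s & t & u & He & Ht & Hu & Hans).
  exists s, t, u. split; [exact He|]. split; [exact Hans|].
  pose proof (main_time_le X q Hq') as Hmt. pose proof (pow3_pos q) as HN.
  pose proof (pow3_pos (length X - 4 * q)) as HB.
  set (N := 3 ^ Z.of_nat q) in *. set (B := 3 ^ Z.of_nat (length X - 4 * q)) in *.
  set (b1 := Z.of_nat (input_size X) + 1) in *.
  split.
  - assert (Hcc : 33 + Z.of_nat (length X) + 6 * N <= 40 * (b1 * Z.of_nat S)).
    { assert (b1 <= b1 * Z.of_nat S) by nia. assert (Z.of_nat S <= b1 * Z.of_nat S) by nia. lia. }
    assert (Hl2 : Z.of_nat lb + 2 <= (Z.of_nat c + Z.of_nat k + 12) * b1)
      by (unfold lb, b1; nia).
    assert (Eu : Z.of_nat (space_bound lb (cell_count X q))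
                 = (33 + Z.of_nat (length X) + 6 * N) * (Z.of_nat lb + 2)).
    { unfold space_bound, cell_count, nregs. fold N.
      rewrite Nat2Z.inj_mul, !Nat2Z.inj_add, Nat2Z.inj_mul, Z2Nat.id by lia. ring. }
    etransitivity; [apply inj_le, Hu|]. rewrite Eu.
    replace (40 * (Z.of_nat c + Z.of_nat k + 12) * b1 ^ 2 * Z.of_nat S)
      with (40 * (b1 * Z.of_nat S) * ((Z.of_nat c + Z.of_nat k + 12) * b1)) by ring.
    apply Z.mul_le_mono_nonneg; lia.
  - set (beta := b1 ^ Z.of_nat k).
    assert (Hbeta : 1 <= beta)
      by (unfold beta; assert (0 < b1 ^ Z.of_nat k) by (apply Z.pow_pos_nonneg; lia); lia).
    assert (HSN : Z.of_nat S <= 3 * (Z.of_nat c + 1) * beta * N).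
    { destruct Hmax as [Hmax|Hmax].
      - etransitivity; [apply (Hbudget (q + 1)%nat); lia|].
        rewrite Nat2Z.inj_add, Z.pow_add_r by lia. fold beta N. change (3 ^ Z.of_nat 1) with 3.
        assert (0 <= beta * N) by nia. nia.
      - assert (3 * N <= 3 * (Z.of_nat c + 1) * beta * N)
          by (apply Z.mul_le_mono_nonneg_r; nia). lia. }
    assert (HSN2 : Z.of_nat S ^ 2 <= (3 * (Z.of_nat c + 1) * beta * N) ^ 2)
      by (apply Z.pow_le_mono_l; lia).
    assert (Hst : step_time lb <= 4000 * ((Z.of_nat c + Z.of_nat k + 11) * b1))
      by (unfold step_time, lb, b1; nia).
    assert (HBNN : 0 <= B * (N * N)) by (clear - HN HB; nia).
    assert (Hmt' : main_time X q <= 250 * b1 ^ 3 * (B * (N * N))).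
    { etransitivity; [exact Hmt|]. apply Z.mul_le_mono_nonneg_r; [exact HBNN|].
      apply Z.mul_le_mono_nonneg_l; [lia|]. apply Z.pow_le_mono_l. lia. }
    assert (Ht' : Z.of_nat t <= 250 * b1 ^ 3 * (B * (N * N)) *
                               (4000 * ((Z.of_nat c + Z.of_nat k + 11) * b1))).
    { assert (HU : 0 <= 250 * b1 ^ 3 * (B * (N * N))).
      { apply Z.mul_nonneg_nonneg; [|exact HBNN].
        apply Z.mul_nonneg_nonneg; [lia|apply Z.pow_nonneg; lia]. }
      pose proof (step_time_pos lb) as Hpos.
      remember (250 * b1 ^ 3 * (B * (N * N))) as U eqn:E; clear E.
      remember (4000 * ((Z.of_nat c + Z.of_nat k + 11) * b1)) as V eqn:E; clear E.
      apply (Z.le_trans _ _ _ Ht), (Z.le_trans _ (U * step_time lb)).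
      - apply Z.mul_le_mono_nonneg_r; lia.
      - apply Z.mul_le_mono_nonneg_l; lia. }
    assert (E3 : 3 ^ Z.of_nat (length X) = B * (N * N) * (N * N)).
    { replace (Z.of_nat (length X)) with
        (Z.of_nat (length X - 4 * q) + (Z.of_nat q + Z.of_nat q) + (Z.of_nat q + Z.of_nat q))
        by (clear - Hq'; lia).
      clear. rewrite !Z.pow_add_r by lia. reflexivity. }
    etransitivity;
      [apply Z.mul_le_mono_nonneg; [lia|exact Ht'|apply Z.pow_nonneg; lia|exact HSN2]|].
    assert (Ebeta : b1 ^ (2 * Z.of_nat k + 4) = beta * beta * b1 ^ 4).
    { unfold beta.
      replace (2 * Z.of_nat k + 4) with (Z.of_nat k + Z.of_nat k + 4) by (clear; lia).
      rewrite !Z.pow_add_r by (clear; lia). reflexivity. }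
    (* Both sides agree exactly: the constant is [250 * 4000 * 3 ^ 2], and [2 * k + 4] collects
       [beta ^ 2] and [b1 ^ 4]. *)
    rewrite E3, Ebeta. apply Z.eq_le_incl. clear. ring.
Qed.

Local Close Scope Z_scope.

Theorem theorem9 (Sp : nat -> nat -> nat)
    (Sp_pos : forall n b : nat, (0 < Sp n b)%nat)
    (Sp_le : Ostar_le (fun X => INR (budget Sp X))
                      (fun X => Rpower 3 (INR (length X) / 4))) :
  exists (P : cmd) (T M : list Z -> nat),
    solves_equal_subset_sum P Sp T M /\
    Ostar_le (fun X => INR (M X)) (fun X => INR (budget Sp X)) /\
    Ostar_le (fun X => INR (T X))
             (fun X => (3 ^ length X / INR (budget Sp X) ^ 2)%R).
Proof.
  destruct Sp_le as (c & k & Hle).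
  (* The existence of a run is only a proposition; choice turns it into functions [T] and [M], with
     arbitrary values on lists that have duplicates. *)
  assert (G : forall X, {tu : nat * nat | NoDup X ->
    exists s, exec main_cmd (init (budget Sp X) X) s (fst tu) (snd tu) /\
      (get (regs s) 0 = 1%Z <-> equal_subset_sum X) /\
      (Z.of_nat (snd tu) <= 40 * (Z.of_nat c + Z.of_nat k + 12)
         * (Z.of_nat (input_size X) + 1) ^ 2 * Z.of_nat (budget Sp X))%Z /\
      (Z.of_nat (fst tu) * Z.of_nat (budget Sp X) ^ 2 <=
         9000000 * (Z.of_nat c + Z.of_nat k + 11) * (Z.of_nat c + 1) ^ 2
         * (Z.of_nat (input_size X) + 1) ^ (2 * Z.of_nat k + 4)
         * 3 ^ Z.of_nat (length X))%Z}).
  { intros X. apply constructive_indefinite_description.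
    destruct (classic (NoDup X)) as [HX|HX]; [|now exists (0, 0)].
    destruct (within_budget X (budget Sp X) c k HX (Sp_pos _ _)) as (s & t & u & H).
    (* Monotonicity of the real power turns [n <= 4 * e] into [3 ^ (n / 4) <= 3 ^ e]. *)
    - intros e He. apply le_IZR.
      rewrite !mult_IZR, <- !pow_IZR, plus_IZR, <- !INR_IZR_INZ.
      eapply Rle_trans; [apply Hle, HX|]. apply Rmult_le_compat_l.
      + apply Rmult_le_pos; [apply pos_INR|]. apply pow_le.
        pose proof (pos_INR (input_size X)). lra.
      + rewrite <- Rpower_pow by lra. apply Rle_Rpower; [lra|].
        apply le_INR in He. rewrite mult_INR in He. cbn [INR] in He. lra.
    - exists (t, u). intros _. exists s. exact H. }
  exists main_cmd, (fun X => fst (proj1_sig (G X))), (fun X => snd (proj1_sig (G X))).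
  split; [|split].
  - intros X HX. destruct (proj2_sig (G X) HX) as (s & He & Hs & _). eauto.
  - exists (Z.to_nat (40 * (Z.of_nat c + Z.of_nat k + 12))), 2%nat. intros X HX.
    destruct (proj2_sig (G X) HX) as (s & _ & _ & Hu & _).
    rewrite !INR_IZR_INZ, Z2Nat.id by lia.
    rewrite <- plus_IZR, pow_IZR, <- !mult_IZR. now apply IZR_le.
  - exists (Z.to_nat (9000000 * (Z.of_nat c + Z.of_nat k + 11) * (Z.of_nat c + 1) ^ 2)),
      (2 * k + 4)%nat. intros X HX.
    destruct (proj2_sig (G X) HX) as (s & _ & _ & _ & Ht).
    set (C := (9000000 * (Z.of_nat c + Z.of_nat k + 11) * (Z.of_nat c + 1) ^ 2)%Z) in *.
    assert (HC : (0 <= C)%Z) by (unfold C; nia).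
    assert (HS : (0 < INR (budget Sp X) ^ 2)%R) by (apply pow_lt, lt_0_INR, Sp_pos).
    apply (Rmult_le_reg_r (INR (budget Sp X) ^ 2)); [exact HS|].
    apply Rle_trans with
      (INR (Z.to_nat C) * (INR (input_size X) + 1) ^ (2 * k + 4) * 3 ^ length X)%R;
      [|right; field; intros E; rewrite E, pow_ne_zero in HS by easy; lra].
    rewrite !INR_IZR_INZ, Z2Nat.id by exact HC.
    rewrite <- plus_IZR, !pow_IZR, <- !mult_IZR. apply IZR_le.
    now replace (Z.of_nat (2 * k + 4)) with (2 * Z.of_nat k + 4)%Z by lia.
Qed.
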